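(* Let $\Omega\Subset\mathbb R^n$ be a bounded open set with smooth $p$-convex boundary ($1\le p\le n$) and let $r\in C^\infty(\overline\Omega)$ be a defining function for $\Omega$ (i.e. $r<0$ in $\Omega$, $r=0$ and $\nabla r\neq0$ on $\partial\Omega$). Then for every strictly $p$-plurisubharmonic function $\varphi\in C^\infty(\overline\Omega)$ there exist constants $K>0$ and $\eta_0\in(0,1)$ such that for every $\eta\in(0,\eta_0)$ the function $\rho:=-(-re^{-K\varphi})^\eta$ is strictly $p$-plurisubharmonic on $\Omega$.
   Context: On $\mathbb R^n$ with the Euclidean metric: a symmetric matrix is $p$-positive definite (resp. semi-definite) if the sum of any $p$ of its eigenvalues (with multiplicity) is positive (resp. nonnegative); a $C^2$ function is $p$-plurisubharmonic (resp. strictly) on a set if its Hessian matrix is $p$-positive semi-definite (resp. definite) at every point of the set. The boundary $\partial\Omega$ is $p$-convex if $\mathrm{tr}_W II_x\ge0$ for every $x\in\partial\Omega$ and every $p$-dimensional subspace $W\subseteq T_x\partial\Omega$, where $II(X,Y)=\langle D_XY,\nu\rangle$ is the second fundamental form with respect to the inward unit normal $\nu$. *)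

(* Defs.v *)
(* classical reals. R^n is modelled by vectors nat -> R whose
   coordinates of index >= n vanish (predicate inRn n). *)
From Stdlib Require Import Reals Lra Lia.
Open Scope R_scope.

Definition vec := nat -> R.

Definition inRn (n : nat) (x : vec) : Prop := forall j, (n <= j)%nat -> x j = 0.

Definition vadd (x y : vec) : vec := fun j => x j + y j.
Definition vsub (x y : vec) : vec := fun j => x j - y j.
Definition vscale (t : R) (x : vec) : vec := fun j => t * x j.
Definition ei (i : nat) : vec := fun j => if Nat.eqb j i then 1 else 0.

Fixpoint sumR (n : nat) (f : nat -> R) : R :=
  match n with O => 0 | S k => sumR k f + f k end.

Definition dot (n : nat) (x y : vec) : R := sumR n (fun j => x j * y j).
Definition norm (n : nat) (x : vec) : R := sqrt (dot n x x).

Definition open_Rn (n : nat) (U : vec -> Prop) : Prop :=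
  forall x, U x -> exists d, 0 < d /\
    forall y, inRn n y -> norm n (vsub y x) < d -> U y.
Definition bounded_Rn (n : nat) (U : vec -> Prop) : Prop :=
  exists M, forall x, U x -> norm n x <= M.
Definition closure (n : nat) (U : vec -> Prop) (x : vec) : Prop :=
  inRn n x /\ forall e, 0 < e -> exists y, U y /\ norm n (vsub y x) < e.
Definition boundary (n : nat) (U : vec -> Prop) (x : vec) : Prop :=
  closure n U x /\ ~ U x.

Definition cont_Rn (n : nat) (f : vec -> R) : Prop :=
  forall x, inRn n x -> forall e, 0 < e -> exists d, 0 < d /\
    forall y, inRn n y -> norm n (vsub y x) < d -> Rabs (f y - f x) < e.

Definition has_partial (f : vec -> R) (i : nat) (x : vec) (l : R) : Prop :=
  derivable_pt_lim (fun t => f (vadd x (vscale t (ei i)))) 0 l.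

Definition smooth (n : nat) (f : vec -> R) : Prop :=
  exists D : list nat -> vec -> R,
    D nil = f /\
    forall l, cont_Rn n (D l) /\
      forall i, (i < n)%nat -> forall x, inRn n x ->
        has_partial (D l) i x (D (cons i l) x).

Definition gradient_at (n : nat) (f : vec -> R) (x : vec) (G : vec) : Prop :=
  forall i, (i < n)%nat -> has_partial f i x (G i).

Definition hessian_at (n : nat) (f : vec -> R) (x : vec) (H : nat -> nat -> R) : Prop :=
  exists g : nat -> vec -> R,
    (exists d, 0 < d /\ forall y, inRn n y -> norm n (vsub y x) < d ->
        forall i, (i < n)%nat -> has_partial f i y (g i y)) /\
    forall i j, (i < n)%nat -> (j < n)%nat -> has_partial (g i) j x (H i j).

Definition matvec (n : nat) (A : nat -> nat -> R) (x : vec) : vec :=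
  fun i => if Nat.ltb i n then sumR n (fun j => A i j * x j) else 0.

Definition symmetric (n : nat) (A : nat -> nat -> R) : Prop :=
  forall i j, (i < n)%nat -> (j < n)%nat -> A i j = A j i.

Definition orthonormal (n m : nat) (v : nat -> vec) : Prop :=
  (forall k, (k < m)%nat -> inRn n (v k)) /\
  forall k l, (k < m)%nat -> (l < m)%nat ->
    dot n (v k) (v l) = if Nat.eqb k l then 1 else 0.

(* (v, lam) is an orthonormal eigenbasis of A; lam 0 .. lam (n-1) are then
   the eigenvalues of A listed with multiplicity. *)
Definition eigenbasis (n : nat) (A : nat -> nat -> R) (v : nat -> vec) (lam : nat -> R) : Prop :=
  orthonormal n n v /\
  forall k, (k < n)%nat -> matvec n A (v k) = vscale (lam k) (v k).

Definition p_pos_def (n p : nat) (A : nat -> nat -> R) : Prop :=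
  symmetric n A /\
  forall v lam, eigenbasis n A v lam ->
    forall s : nat -> nat,
      (forall k, (k < p)%nat -> (s k < n)%nat) ->
      (forall k l, (k < p)%nat -> (l < p)%nat -> s k = s l -> k = l) ->
      0 < sumR p (fun k => lam (s k)).

Definition strictly_p_psh (n p : nat) (f : vec -> R) (S : vec -> Prop) : Prop :=
  forall x, S x -> exists H, hessian_at n f x H /\ p_pos_def n p H.

Definition defining_function (n : nat) (Omega : vec -> Prop) (r : vec -> R) : Prop :=
  (forall x, Omega x -> r x < 0) /\
  (forall x, boundary n Omega x -> r x = 0 /\
      exists G, gradient_at n r x G /\ G <> (fun _ => 0) /\ inRn n G).

(* Second fundamental form of the boundary {r = 0} w.r.t. the inward unit normal
   nu = - grad r / |grad r|:  II_x(X,Y) = Hess r(x)(X,Y) / |grad r(x)|  for X,Y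
   tangent (orthogonal to grad r(x)).  p-convexity: tr_W II_x >= 0 for every
   p-dimensional W in T_x, the trace computed in an orthonormal basis w of W. *)
Definition p_convex_boundary (n p : nat) (Omega : vec -> Prop) (r : vec -> R) : Prop :=
  forall x, boundary n Omega x ->
    forall G H, gradient_at n r x G -> hessian_at n r x H ->
    forall w : nat -> vec, orthonormal n p w ->
      (forall k, (k < p)%nat -> dot n (w k) G = 0) ->
      0 <= sumR p (fun k => dot n (w k) (matvec n H (w k)) / norm n G).

(* Main.v *)
(* Put t = - r and rho = - (t e^{-K phi})^eta.  On Omega, up to the positive factor
   eta (t e^{-K phi})^eta / t^2, the Hessian of rho is the quadratic form
     t Hess r + dr^2 + K t^2 Hess phi - eta (dr + K t dphi)^2.
   Its trace over a p-frame w is estimated term by term.  By compactness tr_w Hess phi >= c > 0.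
   For r, comparing with a boundary point at distance O(t) and with a nearby frame tangent to the boundary
   there, p-convexity gives tr_w Hess r >= - C (t + sum_k |dr(w_k)|) on Omega, and
   C t |dr(w_k)| <= dr(w_k)^2 / 4 + C^2 t^2.  So the K t^2 term wins for K large, and eta is then
   chosen small depending on K.  Positivity of the trace on all orthonormal p-frames is equivalent
   to p-positivity by the spectral theorem and Ky Fan's inequality. *)

Require Import Defs.
From Stdlib Require Import Reals Lra Lia List FunctionalExtensionality Classical ClassicalEpsilon.
Open Scope R_scope.

(** * Sums, bilinear forms and orthonormal frames *)

(** For [eta = 0] the bracketed form is t^2 times the Hessian of - log t + K phi, so the theorem is
    a perturbation of a logarithmic statement. The square dr^2 comes from - log t, and it is what
    absorbs terms linear in dr. Such linear terms are unavoidable: p-convexity speaks only of frames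
    tangent to the boundary, and turning a given frame into a tangent one costs an amount
    proportional to its normal components. If p = n there is no tangent p-frame at all; then the
    normal lies in the span of the frame, its components are not small, and a crude bound on the
    trace suffices. The boundary point used for comparison is not a nearest point. It is where the
    straight line from x in the fixed direction grad r(x) leaves Omega, so no tubular neighbourhood
    is needed, only a lower bound for |grad r| near the boundary and bounds on the derivatives of r
    up to order three. *)

Lemma sumR_ext n f g : (forall i, (i < n)%nat -> f i = g i) -> sumR n f = sumR n g.
Proof.
  induction n as [|n IH]; intros E; simpl; [reflexivity|].
  rewrite IH by (intros; apply E; lia). rewrite E by lia. reflexivity.
Qed.

Lemma sumR_plus n f g : sumR n (fun i => f i + g i) = sumR n f + sumR n g.
Proof. induction n as [|n IH]; simpl; [lra|rewrite IH; ring]. Qed.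

Lemma sumR_minus n f g : sumR n (fun i => f i - g i) = sumR n f - sumR n g.
Proof. induction n as [|n IH]; simpl; [lra|rewrite IH; ring]. Qed.

Lemma sumR_scal n c f : sumR n (fun i => c * f i) = c * sumR n f.
Proof. induction n as [|n IH]; simpl; [lra|rewrite IH; ring]. Qed.

Lemma sumR_const n c : sumR n (fun _ => c) = INR n * c.
Proof. induction n as [|n IH]; [simpl; ring|rewrite S_INR; simpl; rewrite IH; ring]. Qed.

Lemma sumR_eq0 n f : (forall i, (i < n)%nat -> f i = 0) -> sumR n f = 0.
Proof. intros E. rewrite (sumR_ext n f (fun _ => 0) E), sumR_const. ring. Qed.

Lemma sumR_swap n m f :
  sumR n (fun i => sumR m (fun j => f i j)) = sumR m (fun j => sumR n (fun i => f i j)).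
Proof.
  induction n as [|n IH]; simpl.
  - rewrite sumR_eq0; auto.
  - rewrite IH, sumR_plus. reflexivity.
Qed.

Lemma sumR_le n f g : (forall i, (i < n)%nat -> f i <= g i) -> sumR n f <= sumR n g.
Proof.
  induction n as [|n IH]; intros L; simpl; [lra|].
  apply Rplus_le_compat; [apply IH; intros; apply L; lia|apply L; lia].
Qed.

Lemma sumR_nonneg n f : (forall i, (i < n)%nat -> 0 <= f i) -> 0 <= sumR n f.
Proof. intros L. rewrite <- (sumR_eq0 n (fun _ => 0)); auto. apply sumR_le, L. Qed.

Lemma sumR_abs n f : Rabs (sumR n f) <= sumR n (fun i => Rabs (f i)).
Proof.
  induction n as [|n IH]; simpl; [rewrite Rabs_R0; lra|].
  eapply Rle_trans; [apply Rabs_triang|lra].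
Qed.

Lemma sumR_abs_le n f c :
  (forall i, (i < n)%nat -> Rabs (f i) <= c) -> Rabs (sumR n f) <= INR n * c.
Proof.
  intros L. rewrite <- sumR_const.
  eapply Rle_trans; [apply sumR_abs|apply sumR_le, L].
Qed.

Lemma sumR_term_le n f i :
  (forall j, (j < n)%nat -> 0 <= f j) -> (i < n)%nat -> f i <= sumR n f.
Proof.
  induction n as [|n IH]; intros P Hi; [lia|]. simpl.
  destruct (Nat.eq_dec i n) as [->|Hne].
  - assert (0 <= sumR n f) by (apply sumR_nonneg; intros; apply P; lia). lra.
  - assert (f i <= sumR n f) by (apply IH; [intros; apply P; lia|lia]).
    assert (0 <= f n) by (apply P; lia). lra.
Qed.

Lemma sumR_pick n i f : (i < n)%nat -> sumR n (fun j => (if Nat.eqb j i then 1 else 0) * f j) = f i.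
Proof.
  induction n as [|n IH]; intros Hi; [lia|]. simpl.
  destruct (Nat.eq_dec i n) as [->|Hne].
  - rewrite Nat.eqb_refl, sumR_eq0; [ring|].
    intros j Hj. destruct (Nat.eqb_spec j n); [lia|ring].
  - rewrite IH by lia. destruct (Nat.eqb_spec n i); [lia|ring].
Qed.

Lemma sumR_sqr_le n f : sumR n (fun i => f i * f i) <= sumR n (fun i => Rabs (f i)) ^ 2.
Proof.
  induction n as [|n IH]; simpl; [lra|].
  assert (0 <= sumR n (fun i => Rabs (f i))) by (apply sumR_nonneg; intros; apply Rabs_pos).
  assert (f n * f n = Rabs (f n) * Rabs (f n)) by exact (Rsqr_abs (f n)).
  pose proof (Rmult_le_pos _ _ H (Rabs_pos (f n))). simpl in IH. lra.
Qed.

(** Cauchy-Schwarz against the constant 1, read off from the nonnegative double sum of (f i - f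
    j)^2. *)
Lemma sqr_sumR_le n f : sumR n f ^ 2 <= INR n * sumR n (fun i => f i * f i).
Proof.
  assert (H : 0 <= sumR n (fun i => sumR n (fun j => (f i - f j) * (f i - f j)))).
  { apply sumR_nonneg; intros; apply sumR_nonneg; intros; apply Rle_0_sqr. }
  assert (E : sumR n (fun i => sumR n (fun j => (f i - f j) * (f i - f j)))
    = 2 * (INR n * sumR n (fun i => f i * f i)) - 2 * (sumR n f * sumR n f)).
  { rewrite (sumR_ext n _ (fun i => (INR n * (f i * f i) - 2 * sumR n f * f i)
      + sumR n (fun j => f j * f j))).
    - rewrite sumR_plus, sumR_minus, !sumR_scal, sumR_const. ring.
    - intros i _. rewrite (sumR_ext n (fun j => (f i - f j) * (f i - f j))
        (fun j => (f i * f i - (2 * f i) * f j) + f j * f j)) by (intros; ring).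
      rewrite sumR_plus, sumR_minus, sumR_const, (sumR_scal n (2 * f i)). ring. }
  simpl. lra.
Qed.

(** Distances are estimated in this norm because it adds up over coordinates and has no square root;
    the comparison with [norm] costs at most a factor n. *)
Definition norm1 (n : nat) (u : vec) : R := sumR n (fun j => Rabs (u j)).

Lemma norm1_nonneg n u : 0 <= norm1 n u.
Proof. apply sumR_nonneg; intros; apply Rabs_pos. Qed.

Lemma coord_le_norm1 n u j : (j < n)%nat -> Rabs (u j) <= norm1 n u.
Proof. intros Hj. apply (sumR_term_le n (fun j => Rabs (u j))); [intros; apply Rabs_pos|exact Hj]. Qed.

Lemma dot_sym n u v : dot n u v = dot n v u.
Proof. apply sumR_ext. intros; ring. Qed.

Lemma dot_nonneg n u : 0 <= dot n u u.
Proof. apply sumR_nonneg; intros; nra. Qed.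

Lemma dot_vadd_l n u v w : dot n (vadd u v) w = dot n u w + dot n v w.
Proof. unfold dot, vadd. rewrite <- sumR_plus. apply sumR_ext; intros; ring. Qed.

Lemma dot_vsub_l n u v w : dot n (vsub u v) w = dot n u w - dot n v w.
Proof. unfold dot, vsub. rewrite <- sumR_minus. apply sumR_ext; intros; ring. Qed.

Lemma dot_vscale_l n c u w : dot n (vscale c u) w = c * dot n u w.
Proof. unfold dot, vscale. rewrite <- sumR_scal. apply sumR_ext; intros; ring. Qed.

Lemma dot_vadd_r n u v w : dot n w (vadd u v) = dot n w u + dot n w v.
Proof. rewrite !(dot_sym n w). apply dot_vadd_l. Qed.

Lemma dot_vsub_r n u v w : dot n w (vsub u v) = dot n w u - dot n w v.
Proof. rewrite !(dot_sym n w). apply dot_vsub_l. Qed.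

Lemma dot_vscale_r n c u w : dot n w (vscale c u) = c * dot n w u.
Proof. rewrite !(dot_sym n w). apply dot_vscale_l. Qed.

Lemma dot_ei n i u : (i < n)%nat -> dot n (ei i) u = u i.
Proof. apply (sumR_pick n i u). Qed.

Lemma coord_sqr_le_dot n u j : (j < n)%nat -> u j * u j <= dot n u u.
Proof. intros Hj. apply (sumR_term_le n (fun j => u j * u j)); [intros; nra|exact Hj]. Qed.

Lemma norm_le_norm1 n u : norm n u <= norm1 n u.
Proof.
  unfold norm. rewrite <- (sqrt_pow2 (norm1 n u)) by apply norm1_nonneg.
  apply sqrt_le_1_alt, sumR_sqr_le.
Qed.

Lemma coord_le_norm n u j : (j < n)%nat -> Rabs (u j) <= norm n u.
Proof.
  intros Hj. unfold norm. rewrite <- (sqrt_Rsqr_abs (u j)).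
  apply sqrt_le_1_alt, coord_sqr_le_dot, Hj.
Qed.

Lemma dot_bound n u v a b : 0 <= a ->
  (forall i, (i < n)%nat -> Rabs (u i) <= a) -> (forall i, (i < n)%nat -> Rabs (v i) <= b) ->
  Rabs (dot n u v) <= INR n * (a * b).
Proof.
  intros Ha Hu Hv. apply sumR_abs_le. intros i Hi. rewrite Rabs_mult.
  apply Rmult_le_compat; auto using Rabs_pos.
Qed.

Definition bil (n : nat) (A : nat -> nat -> R) (u v : vec) : R :=
  sumR n (fun i => u i * sumR n (fun j => A i j * v j)).

Lemma dot_matvec n A u v : dot n u (matvec n A v) = bil n A u v.
Proof.
  apply sumR_ext. intros i Hi. unfold matvec.
  rewrite (proj2 (Nat.ltb_lt i n) Hi). reflexivity.
Qed.

Lemma bil_vadd_l n A u v w : bil n A (vadd u v) w = bil n A u w + bil n A v w.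
Proof. rewrite <- !dot_matvec. apply dot_vadd_l. Qed.

Lemma bil_vscale_l n A c u w : bil n A (vscale c u) w = c * bil n A u w.
Proof. rewrite <- !dot_matvec. apply dot_vscale_l. Qed.

Lemma bil_vadd_r n A u v w : bil n A w (vadd u v) = bil n A w u + bil n A w v.
Proof.
  unfold bil, vadd. rewrite <- sumR_plus. apply sumR_ext. intros i _.
  rewrite <- Rmult_plus_distr_l, <- sumR_plus. f_equal. apply sumR_ext; intros; ring.
Qed.

Lemma bil_vscale_r n A c u w : bil n A w (vscale c u) = c * bil n A w u.
Proof.
  unfold bil, vscale. rewrite <- sumR_scal. apply sumR_ext. intros i _.
  rewrite (sumR_ext n _ (fun j => c * (A i j * u j))) by (intros; ring).
  rewrite sumR_scal. ring.
Qed.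

Lemma bil_sym n A u v : symmetric n A -> bil n A u v = bil n A v u.
Proof.
  intros S. unfold bil.
  rewrite (sumR_ext n _ (fun i => sumR n (fun j => u i * (A i j * v j))))
    by (intros; rewrite sumR_scal; reflexivity).
  rewrite sumR_swap. apply sumR_ext. intros j Hj. rewrite <- sumR_scal.
  apply sumR_ext. intros i Hi. rewrite (S i j Hi Hj). ring.
Qed.

Lemma bil_bound n A u v a b E : 0 <= a -> 0 <= b ->
  (forall i j, (i < n)%nat -> (j < n)%nat -> Rabs (A i j) <= E) ->
  (forall i, (i < n)%nat -> Rabs (u i) <= a) -> (forall i, (i < n)%nat -> Rabs (v i) <= b) ->
  Rabs (bil n A u v) <= INR n * (a * (INR n * (E * b))).
Proof.
  intros Ha Hb HA Hu Hv. apply sumR_abs_le. intros i Hi. rewrite Rabs_mult.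
  apply Rmult_le_compat; auto using Rabs_pos.
  apply sumR_abs_le. intros j Hj. rewrite Rabs_mult.
  apply Rmult_le_compat; auto using Rabs_pos.
Qed.

Lemma bil_minus_matrix n A B u v :
  bil n (fun i j => A i j - B i j) u v = bil n A u v - bil n B u v.
Proof.
  unfold bil. rewrite <- sumR_minus. apply sumR_ext. intros i _.
  rewrite <- Rmult_minus_distr_l, <- sumR_minus. f_equal. apply sumR_ext; intros; ring.
Qed.

Lemma bil_ext n A B u v :
  (forall i j, (i < n)%nat -> (j < n)%nat -> A i j = B i j) -> bil n A u v = bil n B u v.
Proof.
  intros E. apply sumR_ext. intros i Hi. f_equal. apply sumR_ext. intros j Hj.
  rewrite E; auto.
Qed.

Lemma inRn_vadd n u v : inRn n u -> inRn n v -> inRn n (vadd u v).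
Proof. intros Hu Hv j Hj. unfold vadd. rewrite Hu, Hv by lia. ring. Qed.

Lemma inRn_vsub n u v : inRn n u -> inRn n v -> inRn n (vsub u v).
Proof. intros Hu Hv j Hj. unfold vsub. rewrite Hu, Hv by lia. ring. Qed.

Lemma inRn_vscale n c u : inRn n u -> inRn n (vscale c u).
Proof. intros Hu j Hj. unfold vscale. rewrite Hu by lia. ring. Qed.

Lemma inRn_ei n i : (i < n)%nat -> inRn n (ei i).
Proof. intros Hi j Hj. unfold ei. destruct (Nat.eqb_spec j i); [lia|reflexivity]. Qed.

Lemma inRn_shift n x i t : inRn n x -> (i < n)%nat -> inRn n (vadd x (vscale t (ei i))).
Proof. intros Hx Hi. apply inRn_vadd; [|apply inRn_vscale, inRn_ei]; assumption. Qed.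

Lemma dot_zero n u : inRn n u -> dot n u u = 0 -> u = fun _ => 0.
Proof.
  intros Hu E. apply functional_extensionality. intros j.
  destruct (Nat.lt_ge_cases j n) as [Hj|Hj]; [|apply Hu, Hj].
  pose proof (coord_sqr_le_dot n u j Hj). nra.
Qed.

Lemma orthonormal_unit n p w k : orthonormal n p w -> (k < p)%nat -> dot n (w k) (w k) = 1.
Proof. intros [_ O] Hk. rewrite O, Nat.eqb_refl; auto. Qed.

Lemma unit_coord n u j : dot n u u = 1 -> (j < n)%nat -> Rabs (u j) <= 1.
Proof. intros E Hj. pose proof (coord_sqr_le_dot n u j Hj). apply Rabs_le. nra. Qed.

Lemma orthonormal_coord n p w k j :
  orthonormal n p w -> (k < p)%nat -> (j < n)%nat -> Rabs (w k j) <= 1.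
Proof. intros O Hk. apply unit_coord, (orthonormal_unit n p w k O Hk). Qed.

(** * Orthogonal projection and extension of orthonormal frames *)

Definition lincomb (m : nat) (c : nat -> R) (v : nat -> vec) : vec :=
  fun i => sumR m (fun k => c k * v k i).

Lemma inRn_lincomb n m c v : (forall k, (k < m)%nat -> inRn n (v k)) -> inRn n (lincomb m c v).
Proof. intros H j Hj. apply sumR_eq0. intros k Hk. rewrite (H k Hk j Hj). ring. Qed.

Lemma dot_lincomb_l n m c v u : dot n (lincomb m c v) u = sumR m (fun k => c k * dot n (v k) u).
Proof.
  unfold dot, lincomb.
  rewrite (sumR_ext n _ (fun j => sumR m (fun k => c k * (v k j * u j)))).
  - rewrite sumR_swap. apply sumR_ext. intros k _. apply sumR_scal.
  - intros j _. rewrite Rmult_comm, <- sumR_scal. apply sumR_ext; intros; ring.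
Qed.

Lemma dot_lincomb_orthonormal n m c v l : orthonormal n m v -> (l < m)%nat ->
  dot n (lincomb m c v) (v l) = c l.
Proof.
  intros [_ O] Hl. rewrite dot_lincomb_l, <- (sumR_pick m l c Hl).
  apply sumR_ext. intros k Hk. rewrite O by assumption. ring.
Qed.

Definition residual (n m : nat) (v : nat -> vec) (w : vec) : vec :=
  vsub w (lincomb m (fun k => dot n w (v k)) v).

Lemma inRn_residual n m v w : orthonormal n m v -> inRn n w -> inRn n (residual n m v w).
Proof. intros [I _] Hw. apply inRn_vsub, inRn_lincomb, I. exact Hw. Qed.

Lemma residual_orthogonal n m v w k : orthonormal n m v -> (k < m)%nat ->
  dot n (residual n m v w) (v k) = 0.
Proof. intros O Hk. unfold residual. rewrite dot_vsub_l, dot_lincomb_orthonormal by assumption. ring. Qed.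

Lemma dot_residual n m v w : orthonormal n m v ->
  dot n (residual n m v w) (residual n m v w)
  = dot n w w - sumR m (fun k => dot n w (v k) * dot n w (v k)).
Proof.
  intros O. unfold residual at 2. rewrite dot_vsub_r.
  rewrite (dot_sym n _ (lincomb _ _ _)), dot_lincomb_l.
  rewrite (sumR_eq0 m).
  - unfold residual. rewrite dot_vsub_l, dot_lincomb_l.
    rewrite (sumR_ext m _ (fun k => dot n w (v k) * dot n w (v k)))
      by (intros; rewrite (dot_sym n (v _) w); reflexivity). ring.
  - intros k Hk. rewrite (dot_sym n (v k)), residual_orthogonal by assumption. ring.
Qed.

Lemma bessel n m v w : orthonormal n m v ->
  sumR m (fun k => dot n w (v k) * dot n w (v k)) <= dot n w w.
Proof. intros O. pose proof (dot_residual n m v w O). pose proof (dot_nonneg n (residual n m v w)). lra. Qed.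

Lemma orthonormal_extend n m v u : orthonormal n m v -> inRn n u -> dot n u u = 1 ->
  (forall k, (k < m)%nat -> dot n u (v k) = 0) ->
  orthonormal n (S m) (fun k => if Nat.eqb k m then u else v k).
Proof.
  intros [I O] Hu U P. split.
  - intros k Hk. destruct (Nat.eqb_spec k m); [exact Hu|apply I; lia].
  - intros k l Hk Hl.
    destruct (Nat.eqb_spec k m) as [Ek|Nk], (Nat.eqb_spec l m) as [El|Nl].
    + subst. rewrite Nat.eqb_refl. exact U.
    + destruct (Nat.eqb_spec k l); [lia|]. apply P; lia.
    + destruct (Nat.eqb_spec k l); [lia|]. rewrite dot_sym. apply P; lia.
    + apply O; lia.
Qed.

Lemma normalize n u : 0 < dot n u u ->
  dot n (vscale (/ norm n u) u) (vscale (/ norm n u) u) = 1.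
Proof.
  intros H. rewrite dot_vscale_l, dot_vscale_r. unfold norm.
  pose proof (sqrt_lt_R0 _ H). rewrite <- (sqrt_sqrt (dot n u u)) at 3 by lra.
  field. lra.
Qed.

(* Summing the squared norms of the projections of the standard basis vectors gives m < n,
   so some basis vector has projection of norm less than 1. *)
Lemma orthogonal_unit_exists n m v : orthonormal n m v -> (m < n)%nat ->
  exists u, inRn n u /\ dot n u u = 1 /\ forall k, (k < m)%nat -> dot n u (v k) = 0.
Proof.
  intros O Hm.
  assert (exists i, (i < n)%nat /\ sumR m (fun k => v k i * v k i) < 1) as (i & Hi & Hlt).
  { apply NNPP. intros Hno.
    assert (sumR n (fun _ => 1) <= sumR n (fun i => sumR m (fun k => v k i * v k i))).
    { apply sumR_le. intros i Hi. apply Rnot_lt_le. intros Hlt. apply Hno. eauto. }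
    rewrite sumR_swap, sumR_const in H.
    rewrite (sumR_ext m _ (fun _ => 1)) in H
      by (intros k Hk; apply (orthonormal_unit n m v k O Hk)).
    rewrite sumR_const in H. apply lt_INR in Hm. lra. }
  set (u := residual n m v (ei i)).
  assert (Hu : 0 < dot n u u).
  { unfold u. rewrite dot_residual by assumption. rewrite dot_ei by assumption.
    unfold ei at 1. rewrite Nat.eqb_refl.
    rewrite (sumR_ext m _ (fun k => v k i * v k i))
      by (intros; rewrite !dot_ei by assumption; reflexivity). lra. }
  exists (vscale (/ norm n u) u). split; [|split].
  - apply inRn_vscale, inRn_residual; [exact O|apply inRn_ei, Hi].
  - apply normalize, Hu.
  - intros k Hk. rewrite dot_vscale_l. unfold u.
    rewrite residual_orthogonal by assumption. ring.
Qed.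

(** * Sequential compactness *)

Lemma choice_nat {T : Type} (P : nat -> T -> Prop) :
  (forall N, exists x, P N x) -> exists u, forall N, P N (u N).
Proof.
  intros H. exists (fun N => proj1_sig (constructive_indefinite_description _ (H N))).
  intros N. exact (proj2_sig (constructive_indefinite_description _ (H N))).
Qed.

Lemma cv_const c : Un_cv (fun _ => c) c.
Proof. intros e He. exists 0%nat. intros. rewrite R_dist_eq. exact He. Qed.

(** Subsequences are index maps with [N <= s N]. Monotonicity is not asked for: this condition
    already preserves limits and is stable under composition. *)
Lemma cv_sub u l (s : nat -> nat) :
  Un_cv u l -> (forall N, (N <= s N)%nat) -> Un_cv (fun N => u (s N)) l.
Proof.
  intros H Hs e He. destruct (H e He) as [N HN]. exists N. intros k Hk. apply HN.
  specialize (Hs k). lia.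
Qed.

Lemma cv_ext u v l : (forall N, u N = v N) -> Un_cv u l -> Un_cv v l.
Proof. intros E. replace v with u; [auto|apply functional_extensionality, E]. Qed.

Lemma cv_inv_S : Un_cv (fun N => / (INR N + 1)) 0.
Proof.
  intros e He. destruct (archimed_cor1 e He) as (N & HN & Hpos). exists N. intros k Hk.
  unfold Rdist. rewrite Rminus_0_r. pose proof (pos_INR k). apply lt_0_INR in Hpos as Hp.
  rewrite Rabs_right by (left; apply Rinv_0_lt_compat; lra).
  apply Rlt_trans with (/ INR N); [|exact HN].
  apply le_INR in Hk. apply Rinv_lt_contravar; nra.
Qed.

Lemma cv_unique_const c l : Un_cv (fun _ => c) l -> l = c.
Proof. intros H. exact (UL_sequence _ _ _ H (cv_const c)). Qed.

Lemma cv_le_cv0 u v l : (forall N, u N <= v N) -> Un_cv v 0 -> Un_cv u l -> l <= 0.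
Proof. intros H V U. exact (Rle_cv_lim H U V). Qed.

Lemma cv_sumR n (f : nat -> nat -> R) l :
  (forall i, (i < n)%nat -> Un_cv (fun N => f N i) (l i)) ->
  Un_cv (fun N => sumR n (f N)) (sumR n l).
Proof.
  induction n as [|n IH]; intros H; simpl; [apply cv_const|].
  apply CV_plus; [apply IH; intros; apply H; lia|apply H; lia].
Qed.

(** All indices count, also those from n on, so a limit of vectors in [inRn n] stays there. *)
Definition vec_cv (u : nat -> vec) (x : vec) : Prop := forall j, Un_cv (fun N => u N j) (x j).

Lemma vec_cv_sub u x (s : nat -> nat) :
  vec_cv u x -> (forall N, (N <= s N)%nat) -> vec_cv (fun N => u (s N)) x.
Proof. intros H Hs j. exact (cv_sub _ _ _ (H j) Hs). Qed.

Lemma cv_dot n u v x y : vec_cv u x -> vec_cv v y ->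
  Un_cv (fun N => dot n (u N) (v N)) (dot n x y).
Proof. intros Hu Hv. apply cv_sumR. intros i _. apply CV_mult; auto. Qed.

Lemma cv_bil n (A : nat -> nat -> nat -> R) B u v x y :
  (forall i j, (i < n)%nat -> (j < n)%nat -> Un_cv (fun N => A N i j) (B i j)) ->
  vec_cv u x -> vec_cv v y -> Un_cv (fun N => bil n (A N) (u N) (v N)) (bil n B x y).
Proof.
  intros HA Hu Hv. apply cv_sumR. intros i Hi. apply CV_mult; [apply Hu|].
  apply cv_sumR. intros j Hj. apply CV_mult; auto.
Qed.

Lemma cv_norm1_sub n u x : vec_cv u x -> Un_cv (fun N => norm1 n (vsub (u N) x)) 0.
Proof.
  intros H. replace 0 with (sumR n (fun _ => 0)) by (apply sumR_eq0; auto).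
  apply cv_sumR. intros j _. unfold vsub.
  replace 0 with (Rabs (x j - x j)) by (rewrite Rminus_diag, Rabs_R0; reflexivity).
  apply cv_cvabs, CV_minus; [apply H|apply cv_const].
Qed.

Lemma cv_cont n f u x : cont_Rn n f -> (forall N, inRn n (u N)) -> inRn n x ->
  vec_cv u x -> Un_cv (fun N => f (u N)) (f x).
Proof.
  intros Hf Hu Hx H e He. destruct (Hf x Hx e He) as (d & Hd & HD).
  destruct (cv_norm1_sub n u x H d Hd) as [N HN]. exists N. intros k Hk. apply HD; [apply Hu|].
  specialize (HN k Hk). unfold Rdist in HN. rewrite Rminus_0_r in HN.
  eapply Rle_lt_trans; [apply norm_le_norm1|].
  eapply Rle_lt_trans; [apply Rle_abs|exact HN].
Qed.

Lemma cv_inRn n u x : (forall N, inRn n (u N)) -> vec_cv u x -> inRn n x.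
Proof.
  intros Hu H j Hj. apply cv_unique_const. eapply cv_ext; [|apply H].
  intros N. apply Hu, Hj.
Qed.

Lemma norm1_triang n u v w : norm1 n (vsub u w) <= norm1 n (vsub u v) + norm1 n (vsub v w).
Proof.
  unfold norm1. rewrite <- sumR_plus. apply sumR_le. intros j _. unfold vsub.
  replace (u j - w j) with ((u j - v j) + (v j - w j)) by ring. apply Rabs_triang.
Qed.

Lemma norm1_le_norm n u : norm1 n u <= INR n * norm n u.
Proof.
  rewrite <- sumR_const. apply sumR_le. intros j Hj. apply coord_le_norm, Hj.
Qed.

Lemma cv_closure n U u x : (forall N, closure n U (u N)) -> vec_cv u x -> closure n U x.
Proof.
  intros Hu H. split; [apply (cv_inRn n u); [apply Hu|exact H]|]. intros e He.
  destruct (cv_norm1_sub n u x H (e / 2)) as [N HN]; [lra|].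
  specialize (HN N (Nat.le_refl _)). unfold Rdist in HN. rewrite Rminus_0_r in HN.
  (* The factor n is lost between [norm] and [norm1]; the + 1 keeps the denominator positive for n =
     0. *)
  assert (He' : 0 < e / 2 / (INR n + 1)).
  { pose proof (pos_INR n). apply Rdiv_lt_0_compat; lra. }
  destruct (proj2 (Hu N) _ He') as (y & Uy & Hy). exists y. split; [exact Uy|].
  eapply Rle_lt_trans; [apply norm_le_norm1|].
  eapply Rle_lt_trans; [apply (norm1_triang n y (u N) x)|].
  pose proof (Rle_abs (norm1 n (vsub (u N) x))). pose proof (norm1_le_norm n (vsub y (u N))).
  assert (INR n * norm n (vsub y (u N)) <= e / 2).
  { pose proof (pos_INR n).
    apply Rle_trans with ((INR n + 1) * (e / 2 / (INR n + 1))); [|right; field; lra].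
    apply Rmult_le_compat; try lra. apply sqrt_pos. }
  lra.
Qed.

(** Bolzano-Weierstrass yields a cluster value; picking an index beyond N within 1/(N+1) of it turns
    it into a limit. *)
Lemma bounded_subseq u M : (forall N, Rabs (u N) <= M) ->
  exists (s : nat -> nat) l, (forall N, (N <= s N)%nat) /\ Un_cv (fun N => u (s N)) l.
Proof.
  intros H.
  destruct (Bolzano_Weierstrass u (fun c => - M <= c <= M)) as [l Hl].
  { apply compact_P3. }
  { intros N. specialize (H N). unfold Rabs in H. destruct (Rcase_abs (u N)); lra. }
  assert (forall N, exists k, (N <= k)%nat /\ Rabs (u k - l) < / (INR N + 1)) as HC.
  { intros N. pose proof (pos_INR N).
    assert (P : 0 < / (INR N + 1)) by (apply Rinv_0_lt_compat; lra).
    destruct (Hl (disc l (mkposreal _ P)) N) as (k & Hk & Hd).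
    - exists (mkposreal _ P). intros z Hz. exact Hz.
    - exists k. auto. }
  destruct (choice_nat _ HC) as [s Hs]. exists s, l. split; [intros; apply Hs|].
  intros e He. destruct (cv_inv_S e He) as [N HN]. exists N. intros k Hk.
  specialize (HN k Hk). unfold Rdist in *. rewrite Rminus_0_r in HN.
  eapply Rlt_trans; [apply Hs|]. eapply Rle_lt_trans; [apply Rle_abs|exact HN].
Qed.

Lemma coords_subseq m (u : nat -> nat -> R) M :
  (forall j N, (j < m)%nat -> Rabs (u j N) <= M) ->
  exists (s : nat -> nat) (l : nat -> R), (forall N, (N <= s N)%nat) /\
    forall j, (j < m)%nat -> Un_cv (fun N => u j (s N)) (l j).
Proof.
  induction m as [|m IH]; intros H.
  - exists (fun N => N), (fun _ => 0). split; intros; lia.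
  - destruct IH as (s & l & Hs & Hl); [intros; apply H; lia|].
    destruct (bounded_subseq (fun N => u m (s N)) M) as (s' & l' & Hs' & Hl').
    { intros. apply H. lia. }
    exists (fun N => s (s' N)), (fun j => if Nat.eqb j m then l' else l j). split.
    + intros N. specialize (Hs (s' N)). specialize (Hs' N). lia.
    + intros j Hj. destruct (Nat.eqb_spec j m) as [->|Hne]; [exact Hl'|].
      apply (cv_sub (fun N => u j (s N))); [apply Hl; lia|exact Hs'].
Qed.

Lemma vec_subseq n (u : nat -> vec) M :
  (forall N, inRn n (u N)) -> (forall N j, (j < n)%nat -> Rabs (u N j) <= M) ->
  exists (s : nat -> nat) x, (forall N, (N <= s N)%nat) /\ inRn n x /\ vec_cv (fun N => u (s N)) x.
Proof.
  intros I H. destruct (coords_subseq n (fun j N => u N j) M) as (s & l & Hs & Hl); [auto|].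
  set (x := fun j => if Nat.ltb j n then l j else 0).
  assert (C : vec_cv (fun N => u (s N)) x).
  { intros j. unfold x. destruct (Nat.ltb_spec j n); [auto|].
    apply cv_ext with (fun _ => 0); [|apply cv_const]. intros N. rewrite I; auto. }
  exists s, x. split; [exact Hs|]. split; [|exact C].
  apply (cv_inRn n (fun N => u (s N))); auto.
Qed.

Lemma frame_subseq n p (w : nat -> nat -> vec) : (forall N, orthonormal n p (w N)) ->
  exists (s : nat -> nat) (w' : nat -> vec), (forall N, (N <= s N)%nat) /\ orthonormal n p w' /\
    forall k, (k < p)%nat -> vec_cv (fun N => w (s N) k) (w' k).
Proof.
  intros O.
  (* Extract one vector of the frame at a time; orthonormality is a closed condition and passes to
     the limit afterwards. *)
  assert (HS : forall m, (m <= p)%nat -> exists (s : nat -> nat) (w' : nat -> vec),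
    (forall N, (N <= s N)%nat) /\ forall k, (k < m)%nat -> vec_cv (fun N => w (s N) k) (w' k)).
  { induction m as [|m IH]; intros Hm.
    - exists (fun N => N), (fun _ _ => 0). split; intros; lia.
    - destruct IH as (s & w' & Hs & Hw); [lia|].
      destruct (vec_subseq n (fun N => w (s N) m) 1) as (s' & x & Hs' & _ & Hx).
      { intros N. apply (O (s N)). lia. }
      { intros N j Hj. apply (orthonormal_coord n p); auto. }
      exists (fun N => s (s' N)), (fun k => if Nat.eqb k m then x else w' k). split.
      + intros N. specialize (Hs (s' N)). specialize (Hs' N). lia.
      + intros k Hk. destruct (Nat.eqb_spec k m) as [->|Hne]; [exact Hx|].
        apply (vec_cv_sub (fun N => w (s N) k)); [apply Hw; lia|exact Hs']. }
  destruct (HS p (Nat.le_refl p)) as (s & w' & Hs & Hw).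
  exists s, w'. split; [exact Hs|]. split; [split|exact Hw].
  - intros k Hk. apply (cv_inRn n (fun N => w (s N) k)); [intros; apply (O (s N)), Hk|auto].
  - intros k l Hk Hl. apply cv_unique_const.
    eapply cv_ext; [|apply cv_dot; [apply (Hw k Hk)|apply (Hw l Hl)]].
    intros N. apply (O (s N)); assumption.
Qed.

Lemma cv_not_unbounded (f : nat -> R) l : Un_cv f l -> (forall N, INR N < f N) -> False.
Proof.
  intros H HN. destruct (H 1 Rlt_0_1) as [N0 H0].
  destruct (INR_unbounded (Rabs l + 1)) as [N1 H1].
  specialize (H0 (Nat.max N0 N1) ltac:(lia)). specialize (HN (Nat.max N0 N1)).
  pose proof (le_INR N1 (Nat.max N0 N1) ltac:(lia)).
  unfold Rdist in H0. apply Rabs_def2 in H0. pose proof (Rle_abs l). lra.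
Qed.

(** * Spectral theorem and Ky Fan's inequality *)

Lemma matrix_bounded n (A : nat -> nat -> R) :
  exists E, 0 <= E /\ forall i j, (i < n)%nat -> (j < n)%nat -> Rabs (A i j) <= E.
Proof.
  exists (sumR n (fun i => norm1 n (A i))). split.
  - apply sumR_nonneg. intros. apply norm1_nonneg.
  - intros i j Hi Hj. eapply Rle_trans; [apply (coord_le_norm1 n (A i) j Hj)|].
    apply (sumR_term_le n (fun i => norm1 n (A i))); [intros; apply norm1_nonneg|exact Hi].
Qed.

(** Homogeneity of degree two removes the normalisation. [P] stands for orthogonality to earlier
    vectors; its invariance under scaling is all that matters. *)
Lemma bil_scaled_min n A u mu (P : vec -> Prop) :
  (forall c w, P w -> P (vscale c w)) -> inRn n u ->
  (forall w, inRn n w -> P w -> dot n w w = 1 -> mu <= bil n A w w) ->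
  P u -> mu * dot n u u <= bil n A u u.
Proof.
  intros HP Hu H Pu. destruct (Rle_lt_or_eq_dec _ _ (dot_nonneg n u)) as [Hpos|H0].
  - assert (Hs : norm n u * norm n u = dot n u u) by apply sqrt_sqrt, dot_nonneg.
    assert (Hn : 0 < norm n u) by apply sqrt_lt_R0, Hpos.
    specialize (H (vscale (/ norm n u) u) (inRn_vscale _ _ _ Hu) (HP _ _ Pu) (normalize n u Hpos)).
    rewrite bil_vscale_l, bil_vscale_r, <- Rmult_assoc, <- Rinv_mult, Hs in H.
    apply Rmult_le_reg_r with (/ dot n u u); [apply Rinv_0_lt_compat, Hpos|].
    rewrite Rmult_assoc, Rinv_r by lra. lra.
  - rewrite <- H0, (dot_zero n u Hu (eq_sym H0)).
    unfold bil. rewrite sumR_eq0; [lra|]. intros. ring.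
Qed.

(** Direct method: a minimising sequence of unit vectors in the complement of the frame has a
    convergent subsequence, and its limit attains the infimum. *)
Lemma rayleigh_min n m A v : orthonormal n m v -> (m < n)%nat ->
  exists u, inRn n u /\ dot n u u = 1 /\ (forall k, (k < m)%nat -> dot n u (v k) = 0) /\
    forall w, inRn n w -> (forall k, (k < m)%nat -> dot n w (v k) = 0) ->
      bil n A u u * dot n w w <= bil n A w w.
Proof.
  intros O Hm.
  set (S := fun u => inRn n u /\ dot n u u = 1 /\ forall k, (k < m)%nat -> dot n u (v k) = 0).
  destruct (matrix_bounded n A) as (E & HE & HA).
  (* The sign is reversed because [completeness] provides suprema, so L is minus the infimum of the
     form. *)
  destruct (completeness (fun z => exists u, S u /\ z = - bil n A u u)) as [L [Lub Lleast]].
  { exists (INR n * (1 * (INR n * (E * 1)))). intros z (u & (_ & U & _) & ->).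
    eapply Rle_trans; [apply Rle_abs|]. rewrite Rabs_Ropp.
    apply bil_bound; auto; try lra; intros; apply (unit_coord n u); auto. }
  { destruct (orthogonal_unit_exists n m v O Hm) as (u & Hu). exists (- bil n A u u), u. auto. }
  assert (HC : forall N, exists u, S u /\ - bil n A u u >= L - / (INR N + 1)).
  { intros N. apply NNPP. intros Hno. pose proof (pos_INR N).
    assert (0 < / (INR N + 1)) by (apply Rinv_0_lt_compat; lra).
    assert (L <= L - / (INR N + 1)); [|lra].
    apply Lleast. intros z (u & Su & ->). apply Rnot_lt_le. intros Hlt. apply Hno.
    exists u. split; [exact Su|lra]. }
  destruct (choice_nat _ HC) as [us Hus].
  destruct (vec_subseq n us 1) as (s & u & Hs & Iu & Cu).
  { intros N. apply Hus. }
  { intros N j Hj. apply (unit_coord n); [apply Hus|exact Hj]. }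
  exists u. split; [exact Iu|]. split; [|split].
  - apply cv_unique_const. eapply cv_ext; [|apply (cv_dot n _ _ _ _ Cu Cu)].
    intros N. apply Hus.
  - intros k Hk. apply cv_unique_const.
    eapply cv_ext; [|apply (cv_dot n _ (fun _ => v k) _ _ Cu); intros j; apply cv_const].
    intros N. apply (Hus (s N)), Hk.
  - intros w Iw Pw.
    apply (bil_scaled_min n A w _ (fun w => forall k, (k < m)%nat -> dot n w (v k) = 0)); auto.
    { intros c x Hx k Hk. rewrite dot_vscale_l, Hx by exact Hk. ring. }
    clear w Iw Pw. intros w Iw Pw Uw.
    assert (Hw : - bil n A w w <= L) by (apply Lub; exists w; repeat split; auto).
    assert (bil n A u u + L <= 0); [|lra].
    refine (cv_le_cv0 (fun N => bil n A (us (s N)) (us (s N)) + L) (fun N => / (INR (s N) + 1))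
      _ _ (cv_sub _ _ s cv_inv_S Hs) _).
    + intros N. pose proof (proj2 (Hus (s N))). lra.
    + apply CV_plus; [|apply cv_const]. apply cv_bil; auto. intros. apply cv_const.
Qed.

(** The order of the eigenvalues is encoded variationally: each minimises the Rayleigh quotient on
    the complement of the preceding vectors. Testing with a later eigenvector recovers
    monotonicity. *)
Definition sorted_eigenframe (n m : nat) (A : nat -> nat -> R) (v : nat -> vec) (lam : nat -> R) :=
  orthonormal n m v /\
  (forall k, (k < m)%nat -> matvec n A (v k) = vscale (lam k) (v k)) /\
  (forall k, (k < m)%nat -> forall w, inRn n w ->
    (forall l, (l < k)%nat -> dot n w (v l) = 0) -> lam k * dot n w w <= bil n A w w).

Lemma inRn_matvec n A u : inRn n (matvec n A u).
Proof. intros j Hj. unfold matvec. destruct (Nat.ltb_spec j n); [lia|reflexivity]. Qed.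

(** The values at 1 and -1 force b >= 0; the minimiser t = -a/b then gives -a^2/b >= 0. *)
Lemma quadratic_nonneg_linear_zero a b : (forall t, 0 <= 2 * t * a + t * t * b) -> a = 0.
Proof.
  intros H. destruct (Req_dec b 0) as [->|Hb].
  - pose proof (H (- a)). nra.
  - pose proof (H 1). pose proof (H (-1)). assert (Hb' : 0 < b) by lra.
    pose proof (H (- a / b)) as Ht.
    replace (2 * (- a / b) * a + - a / b * (- a / b) * b) with (- (a * a) / b) in Ht
      by (field; lra).
    assert (0 <= - (a * a)).
    { replace (- (a * a)) with (- (a * a) / b * b) by (field; lra). nra. }
    nra.
Qed.

Lemma bil_eigenvector_orthogonal n A v lam w :
  symmetric n A -> matvec n A v = vscale lam v -> dot n w v = 0 -> bil n A v w = 0.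
Proof.
  intros S E H. rewrite bil_sym by exact S.
  rewrite <- dot_matvec, E, dot_vscale_r, H. ring.
Qed.

(** The next vector is the Rayleigh minimiser u on the complement of the frame found so far. That it
    is an eigenvector follows from its first variation. *)
Lemma sorted_eigenframe_exists n A m : symmetric n A -> (m <= n)%nat ->
  exists v lam, sorted_eigenframe n m A v lam.
Proof.
  intros S. induction m as [|m IH]; intros Hm.
  - exists (fun _ _ => 0), (fun _ => 0). repeat split; intros; lia.
  - destruct IH as (v & lam & O & Eig & Min); [lia|].
    destruct (rayleigh_min n m A v O ltac:(lia)) as (u & Iu & Uu & Pu & Mu).
    set (mu := bil n A u u).
    assert (First : forall w, inRn n w -> (forall k, (k < m)%nat -> dot n w (v k) = 0) ->
      dot n w u = 0 -> bil n A u w = 0).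
    { (* First variation of the Rayleigh quotient along u + t w. *)
      intros w Iw Pw Huw.
      apply (quadratic_nonneg_linear_zero _ (bil n A w w - mu * dot n w w)). intros t.
      pose proof (Mu (vadd u (vscale t w))) as H.
      rewrite !bil_vadd_l, !bil_vadd_r, !bil_vscale_l, !bil_vscale_r in H.
      rewrite !dot_vadd_l, !dot_vadd_r, !dot_vscale_l, !dot_vscale_r in H.
      rewrite (dot_sym n u w), Huw, Uu, (bil_sym n A w u S) in H. fold mu in H.
      assert (Hx : mu * (1 + t * 0 + (t * 0 + t * (t * dot n w w)))
        <= mu + t * bil n A u w + (t * bil n A u w + t * (t * bil n A w w))).
      { eapply Rle_trans; [|eapply Rle_trans; [apply H|]].
        - right; ring.
        - apply inRn_vadd; [|apply inRn_vscale]; assumption.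
        - intros k Hk. rewrite dot_vadd_l, dot_vscale_l, Pu, Pw by exact Hk. ring.
        - right; ring. }
      lra. }
    (* The defect Au - mu u is orthogonal to u and, by symmetry of A, to the earlier eigenvectors.
       It is thus an admissible variation, and <g,g> = A(u,g) = 0. *)
    set (g := vsub (matvec n A u) (vscale mu u)).
    assert (Ig : inRn n g) by (apply inRn_vsub; [apply inRn_matvec|apply inRn_vscale, Iu]).
    assert (Pg : forall k, (k < m)%nat -> dot n g (v k) = 0).
    { intros k Hk. unfold g. rewrite dot_vsub_l, dot_vscale_l, Pu by exact Hk.
      rewrite dot_sym, dot_matvec, (bil_eigenvector_orthogonal n A (v k) (lam k) u);
        auto. ring. }
    assert (Gu : dot n g u = 0).
    { unfold g. rewrite dot_vsub_l, dot_vscale_l, Uu, dot_sym, dot_matvec. fold mu. ring. }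
    assert (G0 : g = fun _ => 0).
    { apply (dot_zero n g Ig). unfold g at 2. rewrite dot_vsub_r, dot_vscale_r, Gu.
      rewrite dot_matvec, (bil_sym n A g u S), (First g Ig Pg Gu). ring. }
    exists (fun k => if Nat.eqb k m then u else v k), (fun k => if Nat.eqb k m then mu else lam k).
    split; [apply orthonormal_extend; assumption|]. split.
    + intros k Hk. destruct (Nat.eqb_spec k m); [|apply Eig; lia].
      apply functional_extensionality. intros j.
      pose proof (f_equal (fun h => h j) G0) as Gj. unfold g, vsub in Gj. lra.
    + intros k Hk w Iw Pw. destruct (Nat.eqb_spec k m) as [->|Hne].
      * apply Mu; [exact Iw|]. intros l Hl. specialize (Pw l Hl).
        destruct (Nat.eqb_spec l m); [lia|exact Pw].
      * apply Min; [lia|exact Iw|]. intros l Hl. specialize (Pw l Hl).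
        destruct (Nat.eqb_spec l m); [lia|exact Pw].
Qed.

Lemma bil_lincomb_l n m A c v w :
  bil n A (lincomb m c v) w = sumR m (fun k => c k * bil n A (v k) w).
Proof.
  rewrite <- dot_matvec, dot_lincomb_l. apply sumR_ext. intros k _.
  rewrite dot_matvec. reflexivity.
Qed.

(** The span of eigenvectors is invariant under A, so it is orthogonal to the residual for the form
    too and no cross terms remain. *)
Lemma bil_residual n m A v lam w : symmetric n A -> orthonormal n m v ->
  (forall k, (k < m)%nat -> matvec n A (v k) = vscale (lam k) (v k)) ->
  bil n A (residual n m v w) (residual n m v w)
  = bil n A w w - sumR m (fun k => lam k * (dot n w (v k) * dot n w (v k))).
Proof.
  intros S O Eig. set (r := residual n m v w).
  assert (E : forall x, bil n A r x = bil n A w x - sumR m (fun k => dot n w (v k) * bil n A (v k) x)).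
  { intros x. rewrite <- bil_lincomb_l, <- !dot_matvec. apply dot_vsub_l. }
  rewrite E, (sumR_eq0 m).
  - rewrite (bil_sym n A w r S), E, Rminus_0_r. f_equal. apply sumR_ext. intros k Hk.
    rewrite (bil_sym n A (v k) w S), <- dot_matvec, Eig, dot_vscale_r by exact Hk. ring.
  - intros k Hk. rewrite (bil_eigenvector_orthogonal n A (v k) (lam k) r); auto; [ring|].
    apply residual_orthogonal; assumption.
Qed.

(* Ky Fan's inequality.  For a unit vector w, splitting off the components on v_0, .., v_{q-1}
   gives A(w,w) >= lam_q - sum_{j<q} (lam_q - lam_j) <w,v_j>^2; then sum over the frame and
   apply Bessel's inequality to each v_j. *)
Lemma trace_ge_lowest_eigenvalues n q A v lam w : symmetric n A ->
  sorted_eigenframe n (S q) A v lam -> orthonormal n (S q) w ->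
  sumR (S q) lam <= sumR (S q) (fun k => bil n A (w k) (w k)).
Proof.
  intros S (O & Eig & Min) W.
  assert (Oq : orthonormal n q v).
  { destruct O as [I O]. split; intros; [apply I|apply O]; lia. }
  assert (Mono : forall j, (j < q)%nat -> lam j <= lam q).
  { intros j Hj. destruct O as [I O].
    pose proof (Min j ltac:(lia) (v q) (I q ltac:(lia))) as H.
    rewrite <- dot_matvec, Eig, dot_vscale_r in H by lia.
    rewrite O, Nat.eqb_refl in H by lia. rewrite !Rmult_1_r in H. apply H.
    intros l Hl. rewrite O by lia. destruct (Nat.eqb_spec q l); [lia|reflexivity]. }
  assert (Each : forall k, (k < Datatypes.S q)%nat ->
    lam q - sumR q (fun j => (lam q - lam j) * (dot n (v j) (w k) * dot n (v j) (w k)))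
    <= bil n A (w k) (w k)).
  { intros k Hk. pose proof (Min q ltac:(lia) (residual n q v (w k))) as H.
    rewrite (bil_residual n q A v lam) in H by (auto; intros; apply Eig; lia).
    rewrite dot_residual, (orthonormal_unit n _ w k W Hk) in H by exact Oq.
    assert (Hx : lam q * (1 - sumR q (fun j => dot n (w k) (v j) * dot n (w k) (v j)))
      <= bil n A (w k) (w k) - sumR q (fun j => lam j * (dot n (w k) (v j) * dot n (w k) (v j)))).
    { apply H; [apply inRn_residual; [exact Oq|apply W, Hk]|].
      intros l Hl. apply residual_orthogonal; assumption. }
    rewrite (sumR_ext q _ (fun j => lam q * (dot n (w k) (v j) * dot n (w k) (v j))
      - lam j * (dot n (w k) (v j) * dot n (w k) (v j))))
      by (intros; rewrite (dot_sym n (v _)); ring).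
    rewrite sumR_minus, sumR_scal. lra. }
  apply Rle_trans with (sumR (Datatypes.S q) (fun k =>
    lam q - sumR q (fun j => (lam q - lam j) * (dot n (v j) (w k) * dot n (v j) (w k)))));
    [|apply sumR_le, Each].
  rewrite sumR_minus, sumR_const, sumR_swap.
  assert (sumR q (fun j => sumR (Datatypes.S q) (fun k =>
    (lam q - lam j) * (dot n (v j) (w k) * dot n (v j) (w k)))) <= sumR q (fun j => lam q - lam j)).
  { apply sumR_le. intros j Hj. rewrite sumR_scal.
    pose proof (bessel n _ w (v j) W) as Bj.
    rewrite (orthonormal_unit n q v j Oq Hj) in Bj. specialize (Mono j Hj).
    rewrite <- (Rmult_1_r (lam q - lam j)) at 2. apply Rmult_le_compat_l; lra. }
  rewrite sumR_minus, sumR_const in H. rewrite S_INR.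
  change (sumR (Datatypes.S q) lam) with (sumR q lam + lam q). lra.
Qed.

(** The sum of the lowest p eigenvalues is positive, being the selection s k = k in a sorted
    eigenbasis, and Ky Fan bounds every trace below by it. *)
Lemma p_pos_def_trace n p A w : (1 <= p)%nat -> (p <= n)%nat -> p_pos_def n p A ->
  orthonormal n p w -> 0 < sumR p (fun k => bil n A (w k) (w k)).
Proof.
  intros Hp Hpn [S Pos] W. destruct p as [|q]; [lia|].
  destruct (sorted_eigenframe_exists n A n S (Nat.le_refl n)) as (v & lam & O & Eig & Min).
  eapply Rlt_le_trans; [|apply (trace_ge_lowest_eigenvalues n q A v lam w S); [|exact W]].
  - apply (Pos v lam (conj O Eig) (fun k => k)); intros; [lia|assumption].
  - split; [|split]; [|intros; apply Eig; lia|intros k Hk; apply Min; lia].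
    destruct O as [I O]. split; intros; [apply I|apply O]; lia.
Qed.

(** Conversely, p distinct members of an eigenbasis form a frame whose trace is the sum of their
    eigenvalues. *)
Lemma p_pos_def_of_trace n p A : symmetric n A ->
  (forall w, orthonormal n p w -> 0 < sumR p (fun k => bil n A (w k) (w k))) -> p_pos_def n p A.
Proof.
  intros S H. split; [exact S|]. intros v lam [[I O] Eig] s Hs Inj.
  specialize (H (fun k => v (s k))).
  rewrite (sumR_ext p _ (fun k => lam (s k))) in H.
  - apply H. split; [intros; apply I; auto|]. intros k l Hk Hl. rewrite O by auto.
    destruct (Nat.eqb_spec (s k) (s l)), (Nat.eqb_spec k l); auto; [|congruence].
    exfalso. auto.
  - intros k Hk. rewrite <- dot_matvec, Eig, dot_vscale_r, O, Nat.eqb_refl by auto. ring.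
Qed.

(** * Partial derivatives of smooth functions *)

(** The condition inside [smooth] with its family of derivatives exposed. The head of a list is the
    direction differentiated last. *)
Definition partial_tower (n : nat) (D : list nat -> vec -> R) : Prop :=
  forall l, cont_Rn n (D l) /\
    forall i, (i < n)%nat -> forall x, inRn n x -> has_partial (D l) i x (D (cons i l) x).

Lemma vadd_zero x i : vadd x (vscale 0 (ei i)) = x.
Proof. apply functional_extensionality; intros j. unfold vadd, vscale. ring. Qed.

Lemma shift_shift x i s t :
  vadd (vadd x (vscale s (ei i))) (vscale t (ei i)) = vadd x (vscale (s + t) (ei i)).
Proof. apply functional_extensionality; intros j. unfold vadd, vscale. ring. Qed.

Lemma shift_comm x i j s t :
  vadd (vadd x (vscale s (ei i))) (vscale t (ei j))
  = vadd (vadd x (vscale t (ei j))) (vscale s (ei i)).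
Proof. apply functional_extensionality; intros k. unfold vadd, vscale. ring. Qed.

Lemma has_partial_line f i x s l : has_partial f i (vadd x (vscale s (ei i))) l ->
  derivable_pt_lim (fun t => f (vadd x (vscale t (ei i)))) s l.
Proof.
  intros H e He. destruct (H e He) as [d Hd]. exists d. intros h Hh Hhd.
  specialize (Hd h Hh Hhd). rewrite !shift_shift, Rplus_0_l, Rplus_0_r in Hd. exact Hd.
Qed.

Lemma has_partial_unique f i x a b : has_partial f i x a -> has_partial f i x b -> a = b.
Proof. apply uniqueness_limite. Qed.

(** Rescaling the segment to [0,1] makes the mean value theorem apply to h of either sign and to h =
    0. *)
Lemma partial_mean_value n f g i x h : (i < n)%nat -> inRn n x ->
  (forall y, inRn n y -> has_partial f i y (g y)) ->
  exists t, 0 <= t <= 1 /\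
    f (vadd x (vscale h (ei i))) - f x = g (vadd x (vscale (t * h) (ei i))) * h.
Proof.
  intros Hi Hx H.
  destruct (MVT_cor2 (fun t => f (vadd x (vscale (t * h) (ei i))))
    (fun t => g (vadd x (vscale (t * h) (ei i))) * h) 0 1 Rlt_0_1) as (t & Ht & Ht01).
  - intros t _.
    apply (derivable_pt_lim_comp (fun t => t * h) (fun s => f (vadd x (vscale s (ei i))))).
    + intros e He. exists (mkposreal 1 Rlt_0_1). intros d Hd _.
      replace (((t + d) * h - t * h) / d - h) with 0 by (field; exact Hd).
      rewrite Rabs_R0. exact He.
    + apply has_partial_line, H, inRn_shift; assumption.
  - exists t. split; [lra|]. rewrite Rmult_1_l, Rmult_0_l, vadd_zero in Ht.
    rewrite Ht. ring.
Qed.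

Lemma ei_diag i : ei i i = 1.
Proof. unfold ei. rewrite Nat.eqb_refl. reflexivity. Qed.

Lemma ei_off i j : j <> i -> ei i j = 0.
Proof. intros H. unfold ei. destruct (Nat.eqb_spec j i); [contradiction|reflexivity]. Qed.

(* Pass from x to y one coordinate at a time.  With c = 0 this is a Lipschitz bound, with c the
   gradient at x a second order Taylor bound. *)
Lemma increment_bound n D l x y (c : nat -> R) B : partial_tower n D -> inRn n x -> inRn n y ->
  (forall k z, (k < n)%nat -> inRn n z -> (forall j, Rabs (z j - x j) <= Rabs (y j - x j)) ->
     Rabs (D (cons k l) z - c k) <= B) ->
  Rabs (D l y - D l x - sumR n (fun k => c k * (y k - x k))) <= B * norm1 n (vsub y x).
Proof.
  intros HD Hx Hy H.
  set (z := fun (m j : nat) => if Nat.ltb j m then y j else x j).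
  assert (Iz : forall m, inRn n (z m)).
  { intros m j Hj. unfold z. destruct (Nat.ltb j m); [apply Hy|apply Hx]; exact Hj. }
  assert (Sz : forall m, z (S m) = vadd (z m) (vscale (y m - x m) (ei m))).
  { intros m. apply functional_extensionality. intros j. unfold z, vadd, vscale.
    destruct (Nat.eq_dec j m) as [->|Hne].
    - rewrite ei_diag. destruct (Nat.ltb_spec m (S m)), (Nat.ltb_spec m m); try lia. ring.
    - rewrite ei_off by exact Hne.
      destruct (Nat.ltb_spec j (S m)), (Nat.ltb_spec j m); try lia; ring. }
  assert (HS : forall m, (m <= n)%nat ->
    Rabs (D l (z m) - D l x - sumR m (fun k => c k * (y k - x k))) <= B * norm1 m (vsub y x)).
  { unfold norm1, vsub. induction m as [|m IH]; intros Hm; simpl.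
    - change (z 0%nat) with x. replace (D l x - D l x - 0) with 0 by ring. rewrite Rabs_R0. lra.
    - destruct (partial_mean_value n (D l) (D (cons m l)) m (z m) (y m - x m))
        as (t & Ht & Hm'); [lia|apply Iz|intros; apply HD; [lia|assumption]|].
      rewrite <- Sz in Hm'.
      set (q := vadd (z m) (vscale (t * (y m - x m)) (ei m))) in *.
      assert (Hq : Rabs (D (cons m l) q - c m) <= B).
      { apply H; [lia|apply inRn_shift; [apply Iz|lia]|].
        intros j. unfold q, z, vadd, vscale. destruct (Nat.eq_dec j m) as [->|Hne].
        - rewrite ei_diag. destruct (Nat.ltb_spec m m); [lia|].
          replace (x m + t * (y m - x m) * 1 - x m) with (t * (y m - x m)) by ring.
          rewrite Rabs_mult, (Rabs_right t) by lra. pose proof (Rabs_pos (y m - x m)). nra.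
        - rewrite ei_off by exact Hne. rewrite Rmult_0_r, Rplus_0_r.
          destruct (Nat.ltb_spec j m); [lra|]. rewrite Rminus_diag, Rabs_R0. apply Rabs_pos. }
      specialize (IH ltac:(lia)).
      replace (D l (z (S m)) - D l x - (sumR m (fun k => c k * (y k - x k)) + c m * (y m - x m)))
        with ((D l (z m) - D l x - sumR m (fun k => c k * (y k - x k)))
              + (D (cons m l) q - c m) * (y m - x m)) by (rewrite Rmult_minus_distr_r, <- Hm'; ring).
      eapply Rle_trans; [apply Rabs_triang|]. rewrite Rabs_mult.
      pose proof (Rmult_le_compat_r _ _ _ (Rabs_pos (y m - x m)) Hq). lra. }
  specialize (HS n (Nat.le_refl n)).
  replace (z n) with y in HS; [exact HS|].
  apply functional_extensionality. intros j. unfold z.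
  destruct (Nat.ltb_spec j n); [reflexivity|]. rewrite Hx, Hy by assumption. reflexivity.
Qed.

(** Boxes rather than balls: bounds on single coordinates are what moving one coordinate at a time
    preserves. *)
Definition in_box (n : nat) (M : R) (x : vec) : Prop :=
  inRn n x /\ forall j, (j < n)%nat -> Rabs (x j) <= M.

Lemma cont_bounded n f M : cont_Rn n f ->
  exists B, 0 <= B /\ forall x, in_box n M x -> Rabs (f x) <= B.
Proof.
  intros Hf. apply NNPP. intros Hno.
  assert (HC : forall N, exists x, in_box n M x /\ INR N < Rabs (f x)).
  { intros N. apply NNPP. intros Hx. apply Hno. exists (INR N). split; [apply pos_INR|].
    intros x Bx. apply Rnot_lt_le. intros Hlt. apply Hx. eauto. }
  destruct (choice_nat _ HC) as [u Hu].
  destruct (vec_subseq n u M) as (s & x & Hs & Ix & Cx); [apply Hu|intros N; apply Hu|].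
  apply (cv_not_unbounded (fun N => Rabs (f (u (s N)))) (Rabs (f x))).
  - apply cv_cvabs, (cv_cont n f); auto. intros N. apply Hu.
  - intros N. eapply Rle_lt_trans; [apply le_INR, (Hs N)|apply Hu].
Qed.

Lemma finite_uniform_bound (P : nat -> R -> Prop) n :
  (forall k B B', P k B -> B <= B' -> P k B') ->
  (forall k, (k < n)%nat -> exists B, 0 <= B /\ P k B) ->
  exists B, 0 <= B /\ forall k, (k < n)%nat -> P k B.
Proof.
  intros Mono. induction n as [|n IH]; intros H.
  - exists 0. split; [lra|intros; lia].
  - destruct IH as (B & HB & PB); [intros; apply H; lia|].
    destruct (H n ltac:(lia)) as (B' & HB' & PB').
    exists (Rmax B B'). split; [eapply Rle_trans; [exact HB|apply Rmax_l]|].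
    intros k Hk. destruct (Nat.eq_dec k n) as [->|Hne].
    + eapply Mono; [exact PB'|apply Rmax_r].
    + eapply Mono; [apply PB; lia|apply Rmax_l].
Qed.

(** Induction peels off the last entry of [l'], the first direction applied to [D l], so the
    induction hypothesis is used with [i :: l] in place of [l]. *)
Lemma partials_bounded n D M m l : partial_tower n D ->
  exists B, 0 <= B /\ forall l', length l' = m -> (forall i, In i l' -> (i < n)%nat) ->
    forall x, in_box n M x -> Rabs (D (l' ++ l) x) <= B.
Proof.
  intros HD. revert l. induction m as [|m IH]; intros l.
  - destruct (cont_bounded n (D l) M) as (B & HB & H); [apply HD|].
    exists B. split; [exact HB|]. intros l' E _ x Hx. destruct l'; [|discriminate].
    apply H, Hx.
  - destruct (finite_uniform_bound (fun i B => forall l', length l' = m ->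
      (forall i, In i l' -> (i < n)%nat) -> forall x, in_box n M x ->
      Rabs (D (l' ++ i :: l) x) <= B) n) as (B & HB & H).
    + intros k B B' P HBB l' E I x Hx. eapply Rle_trans; [apply P; assumption|exact HBB].
    + intros i _. apply IH.
    + exists B. split; [exact HB|]. intros l' E I x Hx.
      destruct (exists_last (l := l')) as (l'' & i & ->); [destruct l'; discriminate|].
      rewrite length_app in E. simpl in E. rewrite <- app_assoc. simpl.
      apply H; [apply I, in_or_app; right; left; reflexivity|lia| |exact Hx].
      intros i' Hi'. apply I, in_or_app. left. exact Hi'.
Qed.

(** Mean value theorem twice: in direction i for the difference of f in direction j, then in
    direction j for the i-th partial. *)
Lemma second_difference n D f i j x h : partial_tower n D -> D nil = f ->
  (i < n)%nat -> (j < n)%nat -> inRn n x ->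
  exists s t, 0 <= s <= 1 /\ 0 <= t <= 1 /\
    f (vadd (vadd x (vscale h (ei i))) (vscale h (ei j))) - f (vadd x (vscale h (ei j)))
      - f (vadd x (vscale h (ei i))) + f x
    = D (j :: i :: nil) (vadd (vadd x (vscale (s * h) (ei i))) (vscale (t * h) (ei j))) * (h * h).
Proof.
  intros HD E Hi Hj Hx.
  destruct (partial_mean_value n (fun y => f (vadd y (vscale h (ei j))) - f y)
    (fun y => D (i :: nil) (vadd y (vscale h (ei j))) - D (i :: nil) y) i x h Hi Hx)
    as (s & Hs & H1).
  { intros y Hy. apply derivable_pt_lim_minus.
    - subst f. pose proof (proj2 (HD nil) i Hi _ (inRn_shift n y j h Hy Hj)) as P.
      unfold has_partial in P. intros e He. destruct (P e He) as [d Hd]. exists d. intros t Ht Htd.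
      rewrite !(shift_comm y i j). apply Hd; assumption.
    - subst f. apply HD; assumption. }
  destruct (partial_mean_value n (D (i :: nil)) (D (j :: i :: nil)) j
    (vadd x (vscale (s * h) (ei i))) h Hj) as (t & Ht & H2).
  { apply inRn_shift; assumption. }
  { intros; apply HD; assumption. }
  exists s, t. split; [exact Hs|split; [exact Ht|]].
  rewrite H2 in H1. lra.
Qed.

Lemma norm1_shift2 n x i j a b : (i < n)%nat -> (j < n)%nat ->
  norm1 n (vsub (vadd (vadd x (vscale a (ei i))) (vscale b (ei j))) x) <= Rabs a + Rabs b.
Proof.
  intros Hi Hj. unfold norm1.
  apply Rle_trans with (sumR n (fun k => ei i k * Rabs a + ei j k * Rabs b)).
  - apply sumR_le. intros k _. unfold vsub, vadd, vscale.
    replace (x k + a * ei i k + b * ei j k - x k) with (a * ei i k + b * ei j k) by ring.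
    eapply Rle_trans; [apply Rabs_triang|]. rewrite !Rabs_mult.
    assert (P : forall i, Rabs (ei i k) = ei i k).
    { intros i'. unfold ei. destruct (Nat.eqb k i'); [apply Rabs_R1|apply Rabs_R0]. }
    rewrite !P. lra.
  - rewrite sumR_plus. unfold ei.
    rewrite (sumR_pick n i (fun _ => Rabs a) Hi), (sumR_pick n j (fun _ => Rabs b) Hj). lra.
Qed.

(** The second difference is symmetric in i and j, so the two mixed derivatives agree at two points
    close to x; continuity moves both to x. This gives the symmetry that [p_pos_def] demands of a
    Hessian. *)
Lemma second_partials_commute n D i j x : partial_tower n D ->
  (i < n)%nat -> (j < n)%nat -> inRn n x ->
  D (j :: i :: nil) x = D (i :: j :: nil) x.
Proof.
  intros HD Hi Hj Hx. apply cond_eq. intros e He.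
  destruct (proj1 (HD (j :: i :: nil)) x Hx (e / 2)) as (d1 & Hd1 & C1); [lra|].
  destruct (proj1 (HD (i :: j :: nil)) x Hx (e / 2)) as (d2 & Hd2 & C2); [lra|].
  (* The intermediate points lie within 2h of x, hence a third. *)
  set (h := Rmin d1 d2 / 3).
  assert (Hm : 0 < Rmin d1 d2) by (apply Rmin_glb_lt; assumption).
  pose proof (Rmin_l d1 d2). pose proof (Rmin_r d1 d2).
  assert (Hh : 0 < h) by (unfold h; lra).
  destruct (second_difference n D (D nil) i j x h HD eq_refl Hi Hj Hx) as (s & t & Hs & Ht & E1).
  destruct (second_difference n D (D nil) j i x h HD eq_refl Hj Hi Hx)
    as (s' & t' & Hs' & Ht' & E2).
  rewrite (shift_comm x j i h h) in E2.
  assert (Near : forall a b i j, (i < n)%nat -> (j < n)%nat -> 0 <= a <= 1 -> 0 <= b <= 1 ->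
    norm n (vsub (vadd (vadd x (vscale (a * h) (ei i))) (vscale (b * h) (ei j))) x)
    < Rmin d1 d2).
  { intros a b i' j' Hi' Hj' Ha Hb. eapply Rle_lt_trans; [apply norm_le_norm1|].
    eapply Rle_lt_trans; [apply norm1_shift2; assumption|].
    rewrite !Rabs_right by nra. unfold h in *. nra. }
  set (y1 := vadd (vadd x (vscale (s * h) (ei i))) (vscale (t * h) (ei j))) in *.
  set (y2 := vadd (vadd x (vscale (s' * h) (ei j))) (vscale (t' * h) (ei i))) in *.
  assert (Eq : D (j :: i :: nil) y1 = D (i :: j :: nil) y2).
  { apply Rmult_eq_reg_r with (h * h); [lra|nra]. }
  assert (N1 : Rabs (D (j :: i :: nil) y1 - D (j :: i :: nil) x) < e / 2).
  { apply C1; [unfold y1; repeat apply inRn_shift; assumption|].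
    eapply Rlt_le_trans; [apply Near; assumption|assumption]. }
  assert (N2 : Rabs (D (i :: j :: nil) y2 - D (i :: j :: nil) x) < e / 2).
  { apply C2; [unfold y2; repeat apply inRn_shift; assumption|].
    eapply Rlt_le_trans; [apply Near; assumption|assumption]. }
  apply Rabs_def2 in N1. apply Rabs_def2 in N2. apply Rabs_def1; lra.
Qed.

Lemma tower_hessian n D x : partial_tower n D -> inRn n x ->
  hessian_at n (D nil) x (fun i j => D (j :: i :: nil) x).
Proof.
  intros HD Hx. exists (fun i => D (i :: nil)). split.
  - exists 1. split; [lra|]. intros y Hy _ i Hi. apply HD; assumption.
  - intros i j Hi Hj. apply HD; assumption.
Qed.

Lemma has_partial_ext_near n f g i x l d : (i < n)%nat -> inRn n x -> 0 < d ->
  (forall y, inRn n y -> norm n (vsub y x) < d -> f y = g y) ->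
  has_partial g i x l -> has_partial f i x l.
Proof.
  intros Hi Hx Hd E H e He. destruct (H e He) as [d' Hd'].
  exists (mkposreal (Rmin d d') ltac:(apply Rmin_glb_lt; [exact Hd|apply d'])).
  simpl. intros h Hh Hhd.
  pose proof (Rmin_l d d'). pose proof (Rmin_r d d').
  assert (N : forall t, Rabs t < d -> norm n (vsub (vadd x (vscale t (ei i))) x) < d).
  { intros t Ht. eapply Rle_lt_trans; [apply norm_le_norm1|].
    rewrite <- (vadd_zero (vadd x (vscale t (ei i))) i).
    eapply Rle_lt_trans; [apply norm1_shift2; assumption|]. rewrite Rabs_R0. lra. }
  rewrite !E; [apply Hd'; [exact Hh|lra]| | | |].
  - apply inRn_shift; assumption.
  - apply N. rewrite Rabs_R0. exact Hd.
  - apply inRn_shift; assumption.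
  - apply N. rewrite Rplus_0_l. lra.
Qed.

(** Identifies a Hessian supplied by a hypothesis with that of the tower. The gradient field in
    [hessian_at] is known only near x, so locality of partial derivatives is used. *)
Lemma hessian_unique n f x H D : partial_tower n D -> D nil = f -> inRn n x ->
  hessian_at n f x H ->
  forall i j, (i < n)%nat -> (j < n)%nat -> H i j = D (j :: i :: nil) x.
Proof.
  intros HD E Hx (g & (d & Hd & G) & HH) i j Hi Hj.
  apply (has_partial_unique (D (i :: nil)) j x); [|apply HD; assumption].
  apply (has_partial_ext_near n _ (g i) j x _ d); auto.
  intros y Hy Hyx. apply (has_partial_unique f i y); [|apply G; assumption].
  subst f. apply HD; assumption.
Qed.

(** * Geometry near the boundary *)

Definition grad (n : nat) (D : list nat -> vec -> R) (x : vec) : vec :=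
  fun i => if Nat.ltb i n then D (i :: nil) x else 0.

Definition hess (D : list nat -> vec -> R) (x : vec) : nat -> nat -> R :=
  fun i j => D (j :: i :: nil) x.

Lemma grad_coord n D x i : (i < n)%nat -> grad n D x i = D (i :: nil) x.
Proof. intros Hi. unfold grad. rewrite (proj2 (Nat.ltb_lt i n) Hi). reflexivity. Qed.

Lemma inRn_grad n D x : inRn n (grad n D x).
Proof. intros j Hj. unfold grad. destruct (Nat.ltb_spec j n); [lia|reflexivity]. Qed.

Lemma tower_gradient n D x : partial_tower n D -> inRn n x -> gradient_at n (D nil) x (grad n D x).
Proof. intros HD Hx i Hi. rewrite grad_coord by exact Hi. apply HD; assumption. Qed.

Lemma cv_grad n D u x : partial_tower n D -> (forall N, inRn n (u N)) -> inRn n x ->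
  vec_cv u x -> vec_cv (fun N => grad n D (u N)) (grad n D x).
Proof.
  intros HD Hu Hx H j. unfold grad. destruct (Nat.ltb_spec j n); [|apply cv_const].
  apply (cv_cont n (D (j :: nil))); auto. apply HD.
Qed.

(** Otherwise points with r > -1/(N+1) and gradients tending to 0 accumulate at a point where r >=
    0. It is outside Omega, hence a boundary point with vanishing gradient. *)
Lemma grad_nondegenerate n Omega D M : partial_tower n D ->
  defining_function n Omega (D nil) -> (forall x, closure n Omega x -> in_box n M x) ->
  exists d m, 0 < d /\ 0 < m /\ forall x, closure n Omega x -> - d < D nil x ->
    m <= dot n (grad n D x) (grad n D x).
Proof.
  intros HD [Neg Bd] Box. apply NNPP. intros Hno.
  assert (HC : forall N, exists x, closure n Omega x /\ - / (INR N + 1) < D nil x /\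
    dot n (grad n D x) (grad n D x) < / (INR N + 1)).
  { intros N. apply NNPP. intros Hx. apply Hno. exists (/ (INR N + 1)), (/ (INR N + 1)).
    assert (0 < / (INR N + 1)) by (pose proof (pos_INR N); apply Rinv_0_lt_compat; lra).
    repeat split; auto. intros x Cx Rx. apply Rnot_lt_le. intros Hlt. apply Hx. eauto. }
  destruct (choice_nat _ HC) as [u Hu].
  destruct (vec_subseq n u M) as (s & x & Hs & Ix & Cx).
  { intros N. apply Hu. }
  { intros N. apply Box, Hu. }
  assert (Iu : forall N, inRn n (u (s N))) by (intros N; apply Hu).
  assert (Clx : closure n Omega x).
  { apply (cv_closure n Omega (fun N => u (s N))); [intros N; apply Hu|exact Cx]. }
  pose proof (cv_sub _ _ s cv_inv_S Hs) as Cs.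
  assert (Rx : - D nil x <= 0).
  { apply (cv_le_cv0 (fun N => - D nil (u (s N))) (fun N => / (INR (s N) + 1))); [|exact Cs|].
    - intros N. pose proof (proj1 (proj2 (Hu (s N)))). lra.
    - apply CV_opp, (cv_cont n (D nil)); auto. apply HD. }
  assert (Gx : dot n (grad n D x) (grad n D x) <= 0).
  { apply (cv_le_cv0 (fun N => dot n (grad n D (u (s N))) (grad n D (u (s N))))
      (fun N => / (INR (s N) + 1))); [|exact Cs|].
    - intros N. pose proof (proj2 (proj2 (Hu (s N)))). lra.
    - apply cv_dot; apply cv_grad; auto. }
  destruct (Bd x) as (_ & G & HG & Gne & GI).
  { split; [exact Clx|]. intros Ox. specialize (Neg x Ox). lra. }
  apply Gne, (dot_zero n G GI).
  rewrite <- (Rle_antisym _ _ Gx (dot_nonneg n (grad n D x))). apply sumR_ext. intros i Hi.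
  rewrite (has_partial_unique _ _ _ _ _ (HG i Hi) (tower_gradient n D x HD Ix i Hi)).
  reflexivity.
Qed.

Lemma norm1_line n x u s s' :
  norm1 n (vsub (vadd x (vscale s u)) (vadd x (vscale s' u))) = Rabs (s - s') * norm1 n u.
Proof.
  unfold norm1. rewrite <- sumR_scal. apply sumR_ext. intros j _.
  unfold vsub, vadd, vscale. rewrite <- Rabs_mult. f_equal. ring.
Qed.

(** The exit time is the supremum t of the times up to which the segment stays in Omega. The point
    at t is a limit of earlier ones; were it in Omega, openness would push t further, up to the end
    S, which is outside. *)
Lemma segment_exit n Omega x u S : open_Rn n Omega -> Omega x -> inRn n x -> inRn n u ->
  0 <= S -> ~ Omega (vadd x (vscale S u)) ->
  exists s, 0 <= s <= S /\ boundary n Omega (vadd x (vscale s u)).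
Proof.
  intros HO Ox Hx Hu HS Out.
  assert (Line : forall s, inRn n (vadd x (vscale s u))).
  { intros. apply inRn_vadd; [|apply inRn_vscale]; assumption. }
  assert (Z : vadd x (vscale 0 u) = x).
  { apply functional_extensionality. intros j. unfold vadd, vscale. ring. }
  assert (Near : forall e, 0 < e -> exists t, 0 < t /\ forall s s', Rabs (s - s') <= t ->
    norm n (vsub (vadd x (vscale s u)) (vadd x (vscale s' u))) < e).
  { intros e He. pose proof (norm1_nonneg n u).
    exists (e / (norm1 n u + 1)). split; [apply Rdiv_lt_0_compat; lra|]. intros s s' Hs.
    eapply Rle_lt_trans; [apply norm_le_norm1|]. rewrite norm1_line.
    apply Rle_lt_trans with (e / (norm1 n u + 1) * norm1 n u).
    - apply Rmult_le_compat_r; assumption.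
    - apply Rlt_le_trans with (e / (norm1 n u + 1) * (norm1 n u + 1)); [|right; field; lra].
      apply Rmult_lt_compat_l; [apply Rdiv_lt_0_compat|]; lra. }
  set (E := fun s => 0 <= s <= S /\ forall s', 0 <= s' <= s -> Omega (vadd x (vscale s' u))).
  assert (E0 : E 0).
  { split; [lra|]. intros s' Hs'. replace s' with 0 by lra. rewrite Z. exact Ox. }
  destruct (completeness E) as (t & Ub & Least).
  { exists S. intros s [Hs _]. lra. }
  { exists 0. exact E0. }
  pose proof (Ub 0 E0).
  assert (tS : t <= S) by (apply Least; intros s [Hs _]; lra).
  assert (Below : forall s, 0 <= s < t -> Omega (vadd x (vscale s u))).
  { intros s Hs. apply NNPP. intros Hno. assert (t <= s); [|lra].
    apply Least. intros s' [_ Hs']. apply Rnot_lt_le. intros Hlt. apply Hno, Hs'. lra. }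
  exists t. split; [lra|]. split; [split; [apply Line|]|].
  - intros e He. destruct (Near e He) as (a & Ha & HN).
    (* Truncation at 0 covers the case where going back by a would leave the segment. *)
    exists (vadd x (vscale (Rmax 0 (t - a)) u)). split.
    + unfold Rmax. destruct (Rle_dec 0 (t - a)); [apply Below; lra|]. rewrite Z. exact Ox.
    + apply HN. unfold Rmax. destruct (Rle_dec 0 (t - a)); apply Rabs_le; lra.
  - intros Ot. destruct (HO _ Ot) as (e & He & Ball). destruct (Near e He) as (a & Ha & HN).
    assert (E1 : E (Rmin S (t + a))).
    { pose proof (Rmin_l S (t + a)). pose proof (Rmin_r S (t + a)). split.
      - split; [apply Rmin_glb; lra|assumption].
      - intros s' Hs'. destruct (Rlt_le_dec s' t) as [Hlt|Hge]; [apply Below; lra|].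
        apply Ball; [apply Line|]. apply HN, Rabs_le. lra. }
    apply Ub in E1. apply Out. replace S with t; [exact Ot|].
    unfold Rmin in E1. destruct (Rle_dec S (t + a)); lra.
Qed.

(** Intermediate points differ from x by at most |y_j - x_j| <= 2M + 1 in each coordinate, hence the
    box of size 3M + 1. The point y gets the margin 1 because the line searching for the boundary
    may leave the closure. *)
Lemma lipschitz_on_box n D l M B : partial_tower n D ->
  (forall k z, (k < n)%nat -> in_box n (3 * M + 1) z -> Rabs (D (k :: l) z) <= B) ->
  forall x y, in_box n M x -> in_box n (M + 1) y ->
    Rabs (D l y - D l x) <= B * norm1 n (vsub y x).
Proof.
  intros HD HB x y [Ix Bx] [Iy By].
  replace (D l y - D l x) with (D l y - D l x - sumR n (fun k => 0 * (y k - x k)))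
    by (rewrite sumR_scal; ring).
  apply increment_bound; auto. intros k z Hk Iz Hz. rewrite Rminus_0_r.
  apply HB; [exact Hk|]. split; [exact Iz|]. intros j Hj.
  specialize (Hz j). specialize (Bx j Hj). specialize (By j Hj).
  pose proof (Rabs_triang (z j - x j) (x j)). pose proof (Rabs_triang (y j) (- x j)).
  rewrite Rabs_Ropp in *. replace (z j - x j + x j) with (z j) in * by ring.
  unfold Rminus in *. lra.
Qed.

(** Follow grad r(x) long enough for the linear part of r to grow by 2t, where t = -r(x). For small
    t the Taylor remainder is at most t, so r >= 0 at the end and the line has left Omega on the
    way. *)
Lemma nearby_boundary_point n Omega D M B1 B2 d m : partial_tower n D ->
  open_Rn n Omega -> (forall x, Omega x -> D nil x < 0) ->
  (forall x, Omega x -> in_box n M x) ->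
  0 <= B1 -> 0 <= B2 -> 0 < d -> 0 < m ->
  (forall i z, (i < n)%nat -> in_box n (3 * M + 1) z -> Rabs (D (i :: nil) z) <= B1) ->
  (forall i j z, (i < n)%nat -> (j < n)%nat -> in_box n (3 * M + 1) z ->
     Rabs (D (j :: i :: nil) z) <= B2) ->
  (forall x, Omega x -> - d < D nil x -> m <= dot n (grad n D x) (grad n D x)) ->
  exists C d', 0 <= C /\ 0 < d' <= d /\ forall x, Omega x -> - d' < D nil x ->
    exists y, boundary n Omega y /\ norm1 n (vsub y x) <= C * - D nil x.
Proof.
  intros HD HO Neg Box HB1 HB2 Hd Hm HG HH Nd.
  pose proof (pos_INR n) as Hn.
  assert (P1 : 0 <= INR n * B2) by (apply Rmult_le_pos; assumption).
  (* The length satisfies S <= 2t/m and |grad r|_1 <= n B1, which gives C. The bound m/(2 B1 + 1)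
     keeps each coordinate displacement at most 1, and m/(4 n B2 + 1) makes the Taylor remainder at
     most t. *)
  exists (2 * (INR n * B1) / m), (Rmin d (Rmin (m / (2 * B1 + 1)) (m / (4 * (INR n * B2) + 1)))).
  split; [|split; [split; [|apply Rmin_l]|]].
  { apply Rmult_le_pos; [|left; apply Rinv_0_lt_compat, Hm].
    apply Rmult_le_pos; [lra|apply Rmult_le_pos; assumption]. }
  { repeat apply Rmin_glb_lt; [exact Hd| |]; apply Rdiv_lt_0_compat; lra. }
  intros x Ox Hr. set (t := - D nil x) in *.
  assert (Ht : 0 < t) by (unfold t; specialize (Neg x Ox); lra).
  pose proof (Rmin_l d (Rmin (m / (2 * B1 + 1)) (m / (4 * (INR n * B2) + 1)))).
  pose proof (Rmin_r d (Rmin (m / (2 * B1 + 1)) (m / (4 * (INR n * B2) + 1)))).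
  pose proof (Rmin_l (m / (2 * B1 + 1)) (m / (4 * (INR n * B2) + 1))).
  pose proof (Rmin_r (m / (2 * B1 + 1)) (m / (4 * (INR n * B2) + 1))).
  assert (T1 : t * (2 * B1 + 1) <= m).
  { replace m with (m / (2 * B1 + 1) * (2 * B1 + 1)) by (field; lra).
    apply Rmult_le_compat_r; [lra|unfold t; lra]. }
  assert (T2 : t * (4 * (INR n * B2) + 1) <= m).
  { replace m with (m / (4 * (INR n * B2) + 1) * (4 * (INR n * B2) + 1)) by (field; lra).
    apply Rmult_le_compat_r; [lra|unfold t; lra]. }
  assert (Hmx : m <= dot n (grad n D x) (grad n D x)) by (apply Nd; [exact Ox|unfold t in *; lra]).
  destruct (Box x Ox) as [Ix Bx].
  set (G := grad n D x) in *. set (g2 := dot n G G) in *.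
  assert (GB : forall j, (j < n)%nat -> Rabs (G j) <= B1).
  { intros j Hj. unfold G. rewrite grad_coord by exact Hj. apply HG; [exact Hj|].
    split; [exact Ix|]. intros i Hi. specialize (Bx i Hi). pose proof (Rabs_pos (x i)). lra. }
  set (S := 2 * t / g2).
  assert (HS : 0 < S) by (apply Rdiv_lt_0_compat; lra).
  assert (Sg : S * g2 = 2 * t) by (unfold S; field; lra).
  assert (Sm : S * m <= 2 * t) by nra.
  assert (N1 : norm1 n G <= INR n * B1).
  { unfold norm1. rewrite <- sumR_const. apply sumR_le. exact GB. }
  assert (N2 : norm1 n G ^ 2 <= INR n * g2).
  { eapply Rle_trans; [apply sqr_sumR_le|]. right. f_equal. apply sumR_ext. intros j _.
    symmetry. exact (Rsqr_abs (G j)). }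
  set (y := vadd x (vscale S G)).
  assert (Iy : inRn n y) by (apply inRn_vadd; [exact Ix|apply inRn_vscale, inRn_grad]).
  assert (Dy : forall j, y j - x j = S * G j) by (intros; unfold y, vadd, vscale; ring).
  assert (NL : forall s, 0 <= s -> norm1 n (vsub (vadd x (vscale s G)) x) = s * norm1 n G).
  { intros s Hs0. unfold norm1. rewrite <- sumR_scal. apply sumR_ext. intros j _.
    unfold vsub, vadd, vscale. replace (x j + s * G j - x j) with (s * G j) by ring.
    rewrite Rabs_mult, (Rabs_right s) by lra. reflexivity. }
  assert (Out : ~ Omega y).
  { intros Oy. specialize (Neg y Oy).
    assert (T : Rabs (D nil y - D nil x - sumR n (fun k => D (k :: nil) x * (y k - x k)))
      <= B2 * norm1 n (vsub y x) * norm1 n (vsub y x)).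
    { apply increment_bound; auto. intros k z Hk Iz Hz.
      eapply Rle_trans; [apply (lipschitz_on_box n D (k :: nil) M B2); auto|].
      - split; [exact Iz|]. intros j Hj. specialize (Hz j). rewrite Dy, Rabs_mult in Hz.
        rewrite (Rabs_right S) in Hz by lra.
        pose proof (Rabs_triang (z j - x j) (x j)) as Tr.
        replace (z j - x j + x j) with (z j) in Tr by ring.
        specialize (Bx j Hj). specialize (GB j Hj).
        assert (S * Rabs (G j) <= 1); [|lra].
        apply Rle_trans with (S * B1); [apply Rmult_le_compat_l; lra|].
        apply Rmult_le_reg_r with m; [exact Hm|].
        apply Rle_trans with (2 * t * B1); [nra|]. nra.
      - apply Rmult_le_compat_l; [exact HB2|]. apply sumR_le. intros j _. apply Hz. }
    rewrite (sumR_ext n _ (fun k => S * (G k * G k))), sumR_scal in T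
      by (intros; rewrite Dy; unfold G at 2; rewrite grad_coord by assumption; ring).
    fold (dot n G G) in T. fold g2 in T. rewrite Sg in T.
    unfold y in T at 2 3. rewrite NL in T by lra.
    (* Quadratic remainder: |G|_1^2 <= n |G|^2 and S |G|^2 = 2t reduce it to 2 n B2 S t, at most 4 n
       B2 t^2 / m. *)
    assert (Q : B2 * (S * norm1 n G) * (S * norm1 n G) <= t).
    { apply Rle_trans with (S * (B2 * (INR n * (S * g2)))).
      - replace (B2 * (S * norm1 n G) * (S * norm1 n G)) with (S * (B2 * (S * norm1 n G ^ 2)))
          by ring.
        replace (INR n * (S * g2)) with (S * (INR n * g2)) by ring.
        repeat apply Rmult_le_compat_l; lra.
      - rewrite Sg. apply Rmult_le_reg_r with m; [exact Hm|].
        replace (S * (B2 * (INR n * (2 * t))) * m) with (S * m * (2 * t * (INR n * B2))) by ring.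
        apply Rle_trans with (2 * t * (2 * t * (INR n * B2))).
        + apply Rmult_le_compat_r; [apply Rmult_le_pos; lra|exact Sm].
        + replace (2 * t * (2 * t * (INR n * B2))) with (t * (t * (4 * (INR n * B2)))) by ring.
          apply Rmult_le_compat_l; lra. }
    pose proof (Rle_abs (- (D nil y - D nil x - 2 * t))) as A. rewrite Rabs_Ropp in A.
    unfold t in *. lra. }
  destruct (segment_exit n Omega x G S HO Ox Ix (inRn_grad n D x) ltac:(lra) Out) as (s & Hs & Bs).
  exists (vadd x (vscale s G)). split; [exact Bs|]. rewrite NL by lra.
  apply Rle_trans with (S * (INR n * B1)).
  - apply Rmult_le_compat; try lra. apply norm1_nonneg.
  - apply Rmult_le_reg_r with m; [exact Hm|].
    replace (2 * (INR n * B1) / m * t * m) with (2 * t * (INR n * B1)) by (field; lra).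
    replace (S * (INR n * B1) * m) with (S * m * (INR n * B1)) by ring.
    apply Rmult_le_compat_r; [apply Rmult_le_pos; assumption|exact Sm].
Qed.

(* With z the projection of nu onto the span W of the frame and q = sqrt(1 - |z|^2), the vector
   y = z/(q(1+q)) - nu/q is the one for which w_k + <w_k,nu> y is the image of w_k under the
   rotation that moves z to its component orthogonal to nu and fixes the complement of z in W. *)
Lemma tangent_frame n p w nu : orthonormal n p w -> inRn n nu -> dot n nu nu = 1 ->
  sumR p (fun k => dot n (w k) nu * dot n (w k) nu) < 1 ->
  exists y, inRn n y /\ dot n y y <= 2 /\
    orthonormal n p (fun k => vadd (w k) (vscale (dot n (w k) nu) y)) /\
    forall k, (k < p)%nat -> dot n (vadd (w k) (vscale (dot n (w k) nu) y)) nu = 0.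
Proof.
  intros W Inu Unu Hb. set (b := fun k => dot n (w k) nu) in *.
  set (q := sqrt (1 - sumR p (fun k => b k * b k))).
  assert (Hq : 0 < q) by (apply sqrt_lt_R0; unfold b; lra).
  assert (Hqq : sumR p (fun k => b k * b k) = 1 - q * q).
  { unfold q. rewrite sqrt_sqrt by (unfold b; lra). ring. }
  set (z := lincomb p b w).
  assert (zw : forall k, (k < p)%nat -> dot n (w k) z = b k).
  { intros k Hk. rewrite dot_sym. apply dot_lincomb_orthonormal; assumption. }
  assert (znu : dot n z nu = 1 - q * q) by (unfold z; rewrite dot_lincomb_l; exact Hqq).
  assert (zz : dot n z z = 1 - q * q).
  { unfold z at 1. rewrite dot_lincomb_l, <- Hqq. apply sumR_ext. intros k Hk.
    rewrite zw by exact Hk. reflexivity. }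
  set (y := vsub (vscale (/ (q * (1 + q))) z) (vscale (/ q) nu)).
  assert (wy : forall k, (k < p)%nat -> dot n (w k) y = - b k / (1 + q)).
  { intros k Hk. unfold y. rewrite dot_vsub_r, !dot_vscale_r, zw by exact Hk. fold (b k).
    field. lra. }
  assert (ynu : dot n y nu = -1).
  { unfold y. rewrite dot_vsub_l, !dot_vscale_l, znu, Unu. field. lra. }
  assert (yy : dot n y y = 2 / (1 + q)).
  { unfold y at 2. rewrite dot_vsub_r, !dot_vscale_r, ynu. unfold y.
    rewrite dot_vsub_l, !dot_vscale_l, zz, (dot_sym n nu z), znu. field. lra. }
  exists y. split; [|split; [|split; [split|]]].
  - apply inRn_vsub; apply inRn_vscale; [apply inRn_lincomb; intros; apply W; assumption|exact Inu].
  - rewrite yy. apply Rmult_le_reg_r with (1 + q); [lra|].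
    replace (2 / (1 + q) * (1 + q)) with 2 by (field; lra). lra.
  - intros k Hk. apply inRn_vadd, inRn_vscale, inRn_vsub; [apply W, Hk| |];
      apply inRn_vscale; [apply inRn_lincomb; intros; apply W; assumption|exact Inu].
  - intros k l Hk Hl. rewrite !dot_vadd_l, !dot_vadd_r, !dot_vscale_l, !dot_vscale_r.
    rewrite (dot_sym n y (w l)), !wy, yy by assumption. rewrite (proj2 W k l Hk Hl).
    fold (b k) (b l). destruct (Nat.eqb k l); field; lra.
  - intros k Hk. rewrite dot_vadd_l, dot_vscale_l, ynu. fold (b k). ring.
Qed.

Lemma trace_lower_bound n p H E w : (forall i j, (i < n)%nat -> (j < n)%nat -> Rabs (H i j) <= E) ->
  orthonormal n p w ->
  - (INR p * (INR n * (INR n * E))) <= sumR p (fun k => bil n H (w k) (w k)).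
Proof.
  intros HE W.
  assert (Rabs (sumR p (fun k => bil n H (w k) (w k))) <= INR p * (INR n * (INR n * E))) as A.
  { apply sumR_abs_le. intros k Hk.
    replace (INR n * (INR n * E)) with (INR n * (1 * (INR n * (E * 1)))) by ring.
    apply bil_bound; try lra; auto; intros; apply (orthonormal_coord n p); assumption. }
  unfold Rabs in A. destruct (Rcase_abs _); lra.
Qed.

(** Let b_k be the components along the unit normal. If their squares sum to less than 1, the
    rotated tangent frame changes each diagonal term by b(X + Y + bZ), where |X| and |Y| are at most
    2A and |Z| at most 4A: this is the 8. Otherwise the |b_k| sum to at least 1 and the crude bound
    pA suffices: this is the p. The second case includes p = n. *)
Lemma trace_near_tangent n p H G E w : 0 <= E ->
  (forall i j, (i < n)%nat -> (j < n)%nat -> Rabs (H i j) <= E) ->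
  inRn n G -> 0 < dot n G G -> orthonormal n p w ->
  (forall w', orthonormal n p w' -> (forall k, (k < p)%nat -> dot n (w' k) G = 0) ->
     0 <= sumR p (fun k => bil n H (w' k) (w' k))) ->
  - ((8 + INR p) * (INR n * (INR n * E)) / norm n G * sumR p (fun k => Rabs (dot n (w k) G)))
  <= sumR p (fun k => bil n H (w k) (w k)).
Proof.
  intros HE HH IG HG W Tan. set (A := INR n * (INR n * E)).
  assert (HA : 0 <= A) by (pose proof (pos_INR n); repeat apply Rmult_le_pos; assumption).
  assert (Ng : 0 < norm n G) by apply sqrt_lt_R0, HG.
  set (nu := vscale (/ norm n G) G). set (b := fun k => dot n (w k) nu).
  assert (Eb : sumR p (fun k => Rabs (b k)) = / norm n G * sumR p (fun k => Rabs (dot n (w k) G))).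
  { rewrite <- sumR_scal. apply sumR_ext. intros k _. unfold b, nu.
    rewrite dot_vscale_r, Rabs_mult, Rabs_right; [reflexivity|].
    left. apply Rinv_0_lt_compat, Ng. }
  unfold Rdiv. rewrite Rmult_assoc, <- Eb.
  assert (Pb : 0 <= sumR p (fun k => Rabs (b k))) by (apply sumR_nonneg; intros; apply Rabs_pos).
  pose proof (pos_INR p) as Hp.
  destruct (Rlt_le_dec (sumR p (fun k => b k * b k)) 1) as [Hlt|Hge].
  - destruct (tangent_frame n p w nu W (inRn_vscale _ _ _ IG) (normalize n G HG) Hlt)
      as (y & Iy & Uy & W' & T').
    assert (Sum : 0 <= sumR p (fun k => bil n H (w k) (w k) + 8 * A * Rabs (b k))).
    { eapply Rle_trans; [apply (Tan _ W')|].
      - intros k Hk. specialize (T' k Hk). unfold nu in T' at 2. rewrite dot_vscale_r in T'.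
        apply Rmult_integral in T'. destruct T' as [T'|T']; [|exact T'].
        pose proof (Rinv_0_lt_compat _ Ng). lra.
      - apply sumR_le. intros k Hk. fold (b k).
        rewrite bil_vadd_l, !bil_vadd_r, !bil_vscale_l, !bil_vscale_r.
        assert (Cw : forall i, (i < n)%nat -> Rabs (w k i) <= 1)
          by (intros; apply (orthonormal_coord n p); assumption).
        assert (Cy : forall i, (i < n)%nat -> Rabs (y i) <= 2).
        { intros i Hi. pose proof (coord_sqr_le_dot n y i Hi). apply Rabs_le. nra. }
        assert (B1 : Rabs (bil n H (w k) y) <= 2 * A).
        { eapply Rle_trans; [apply (bil_bound n H _ _ 1 2 E); auto; lra|unfold A; right; ring]. }
        assert (B2 : Rabs (bil n H y (w k)) <= 2 * A).
        { eapply Rle_trans; [apply (bil_bound n H _ _ 2 1 E); auto; lra|unfold A; right; ring]. }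
        assert (B3 : Rabs (bil n H y y) <= 4 * A).
        { eapply Rle_trans; [apply (bil_bound n H _ _ 2 2 E); auto; lra|unfold A; right; ring]. }
        assert (Bb : Rabs (b k) <= 1).
        { assert (b k * b k <= 1); [|apply Rabs_le; nra].
          apply Rle_trans with (sumR p (fun k => b k * b k)); [|lra].
          apply (sumR_term_le p (fun k => b k * b k)); [intros; apply Rle_0_sqr|exact Hk]. }
        set (X := bil n H (w k) y) in *. set (Y := bil n H y (w k)) in *.
        set (Z := bil n H y y) in *.
        assert (Rabs (b k * X + (b k * Y + b k * (b k * Z))) <= 8 * A * Rabs (b k)).
        { replace (b k * X + (b k * Y + b k * (b k * Z))) with (b k * (X + Y + b k * Z)) by ring.
          rewrite Rabs_mult, Rmult_comm. apply Rmult_le_compat_r; [apply Rabs_pos|].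
          eapply Rle_trans; [apply Rabs_triang|]. rewrite Rabs_mult.
          pose proof (Rabs_triang X Y). pose proof (Rabs_pos Z). pose proof (Rabs_pos (b k)). nra. }
        pose proof (Rle_abs (b k * X + (b k * Y + b k * (b k * Z)))). lra. }
    rewrite sumR_plus, sumR_scal in Sum.
    assert (0 <= INR p * A * sumR p (fun k => Rabs (b k)))
      by (apply Rmult_le_pos; [apply Rmult_le_pos|]; assumption).
    lra.
  - eapply Rle_trans; [|apply (trace_lower_bound n p H E w HH W)]. fold A.
    pose proof (sumR_sqr_le p b).
    assert (1 <= sumR p (fun k => Rabs (b k))) by nra.
    assert (INR p * A * 1 <= (8 + INR p) * A * sumR p (fun k => Rabs (b k))).
    { apply Rmult_le_compat; try lra. apply Rmult_le_pos; lra. }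
    lra.
Qed.

(** * Trace estimates and the Hessian of the exhaustion *)

Lemma subset_closure n Omega x : (forall x, Omega x -> inRn n x) -> Omega x -> closure n Omega x.
Proof.
  intros HI Ox. split; [apply HI, Ox|]. intros e He. exists x. split; [exact Ox|].
  eapply Rle_lt_trans; [apply norm_le_norm1|]. unfold norm1.
  rewrite sumR_eq0; [exact He|]. intros j _. unfold vsub. rewrite Rminus_diag. apply Rabs_R0.
Qed.

Lemma closure_in_box n Omega : bounded_Rn n Omega ->
  exists M, forall x, closure n Omega x -> in_box n M x.
Proof.
  intros [M HM]. exists (M + 1). intros x [Ix Cx]. split; [exact Ix|]. intros j Hj.
  destruct (Cx 1 Rlt_0_1) as (y & Oy & Hy).
  pose proof (coord_le_norm n (vsub y x) j Hj) as Hv. unfold vsub at 1 in Hv.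
  pose proof (coord_le_norm n y j Hj). specialize (HM y Oy).
  pose proof (Rabs_triang (y j) (- (y j - x j))) as Tr. rewrite Rabs_Ropp in Tr.
  replace (y j + - (y j - x j)) with (x j) in Tr by ring. lra.
Qed.

(** Compactness of pairs of a point of the closure and a p-frame: a violating sequence would have a
    limit pair with trace at most 0. *)
Lemma uniform_trace_positive n p Omega D M : partial_tower n D ->
  (1 <= p)%nat -> (p <= n)%nat -> (forall x, closure n Omega x -> in_box n M x) ->
  strictly_p_psh n p (D nil) (closure n Omega) ->
  exists c, 0 < c /\ forall x w, closure n Omega x -> orthonormal n p w ->
    c <= sumR p (fun k => bil n (hess D x) (w k) (w k)).
Proof.
  intros HD Hp Hpn Box Psh. apply NNPP. intros Hno.
  assert (HC : forall N, exists xw : vec * (nat -> vec), closure n Omega (fst xw) /\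
    orthonormal n p (snd xw) /\
    sumR p (fun k => bil n (hess D (fst xw)) (snd xw k) (snd xw k)) < / (INR N + 1)).
  { intros N. apply NNPP. intros Hx. apply Hno. exists (/ (INR N + 1)).
    split; [pose proof (pos_INR N); apply Rinv_0_lt_compat; lra|].
    intros x w Cx W. apply Rnot_lt_le. intros Hlt. apply Hx. exists (x, w). auto. }
  destruct (choice_nat _ HC) as [u Hu].
  destruct (vec_subseq n (fun N => fst (u N)) M) as (s & x & Hs & Ix & Cx).
  { intros N. apply Hu. }
  { intros N. apply Box, Hu. }
  destruct (frame_subseq n p (fun N => snd (u (s N)))) as (s' & w & Hs' & W & Cw).
  { intros N. apply Hu. }
  apply (vec_cv_sub _ _ s') in Cx; [|exact Hs'].
  assert (Clx : closure n Omega x).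
  { apply (cv_closure n Omega (fun N => fst (u (s (s' N))))); [intros N; apply Hu|exact Cx]. }
  destruct (Psh x Clx) as (H & HH & Pos).
  pose proof (p_pos_def_trace n p H w Hp Hpn Pos W) as Hpos.
  rewrite (sumR_ext p _ (fun k => bil n (hess D x) (w k) (w k))) in Hpos.
  2:{ intros k _. apply bil_ext. intros i j Hi Hj.
      apply (hessian_unique n (D nil) x H D); auto. }
  apply (Rlt_not_le _ _ Hpos).
  apply (cv_le_cv0 (fun N => sumR p (fun k => bil n (hess D (fst (u (s (s' N)))))
    (snd (u (s (s' N))) k) (snd (u (s (s' N))) k))) (fun N => / (INR (s (s' N)) + 1))).
  - intros N. left. apply Hu.
  - apply (cv_sub _ _ (fun N => s (s' N)) cv_inv_S). intros N.
    specialize (Hs (s' N)). specialize (Hs' N). lia.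
  - apply cv_sumR. intros k Hk. apply cv_bil; auto. intros i j Hi Hj. unfold hess.
    apply (cv_cont n (D (j :: i :: nil))); auto; [apply HD|]. intros N. apply Hu.
Qed.

(* If -r(x) is small, compare with a boundary point at distance O(-r(x)); otherwise the bound only
   says that the trace is bounded. *)
Lemma trace_defining_function n p Omega D M : partial_tower n D -> (forall x, Omega x -> inRn n x) ->
  open_Rn n Omega -> defining_function n Omega (D nil) -> p_convex_boundary n p Omega (D nil) ->
  (forall x, closure n Omega x -> in_box n M x) ->
  exists C, 0 <= C /\ forall x w, Omega x -> orthonormal n p w ->
    - (C * (- D nil x + sumR p (fun k => Rabs (dot n (w k) (grad n D x)))))
    <= sumR p (fun k => bil n (hess D x) (w k) (w k)).
Proof.
  intros HD HI HO Def Conv Box. pose proof (proj1 Def) as Neg.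
  assert (Sub : forall x, Omega x -> closure n Omega x) by (intros; apply subset_closure; assumption).
  assert (Big : forall x, in_box n M x -> in_box n (3 * M + 1) x).
  { intros x [Ix Bx]. split; [exact Ix|]. intros j Hj. specialize (Bx j Hj).
    pose proof (Rabs_pos (x j)). lra. }
  destruct (partials_bounded n D (3 * M + 1) 1 nil HD) as (B1 & HB1 & P1).
  destruct (partials_bounded n D (3 * M + 1) 2 nil HD) as (B2 & HB2 & P2).
  destruct (partials_bounded n D (3 * M + 1) 3 nil HD) as (B3 & HB3 & P3).
  assert (Q1 : forall i z, (i < n)%nat -> in_box n (3 * M + 1) z -> Rabs (D (i :: nil) z) <= B1).
  { intros i z Hi. apply (P1 (i :: nil)); [reflexivity|]. intros a [<-|[]]; exact Hi. }
  assert (Q2 : forall i j z, (i < n)%nat -> (j < n)%nat -> in_box n (3 * M + 1) z ->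
    Rabs (D (j :: i :: nil) z) <= B2).
  { intros i j z Hi Hj. apply (P2 (j :: i :: nil)); [reflexivity|].
    intros a [<-|[<-|[]]]; assumption. }
  assert (Q3 : forall i j k z, (i < n)%nat -> (j < n)%nat -> (k < n)%nat ->
    in_box n (3 * M + 1) z -> Rabs (D (k :: j :: i :: nil) z) <= B3).
  { intros i j k z Hi Hj Hk. apply (P3 (k :: j :: i :: nil)); [reflexivity|].
    intros a [<-|[<-|[<-|[]]]]; assumption. }
  destruct (grad_nondegenerate n Omega D M HD Def Box) as (d0 & m & Hd0 & Hm & Nd).
  destruct (nearby_boundary_point n Omega D M B1 B2 d0 m) as (C0 & d & HC0 & [Hd Hdd] & NB); auto.
  set (A := INR n * (INR n * B2)).
  pose proof (pos_INR n) as Hn. pose proof (pos_INR p) as Hp.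
  assert (HA : 0 <= A) by (apply Rmult_le_pos; [|apply Rmult_le_pos]; assumption).
  (* The constant of the tangent-frame estimate, with |grad r(y)| >= sqrt m at the boundary point
     y. *)
  set (C1 := (8 + INR p) * A / sqrt m).
  assert (Hsm : 0 < sqrt m) by (apply sqrt_lt_R0, Hm).
  assert (HC1 : 0 <= C1).
  { apply Rmult_le_pos; [apply Rmult_le_pos; lra|left; apply Rinv_0_lt_compat, Hsm]. }
  (* Costs per unit of t of moving between x and y: [E3] for the trace of Hess r, [E2] for the sum
     of |dr(w_k)|. *)
  set (E3 := INR p * (INR n * (INR n * (B3 * C0)))).
  set (E2 := INR p * (INR n * (B2 * C0))).
  assert (HE3 : 0 <= E3) by (unfold E3; repeat apply Rmult_le_pos; assumption).
  assert (HE2 : 0 <= E2) by (unfold E2; repeat apply Rmult_le_pos; assumption).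
  assert (HpA : 0 <= INR p * A / d).
  { apply Rmult_le_pos; [apply Rmult_le_pos; assumption|left; apply Rinv_0_lt_compat, Hd]. }
  assert (HCE : 0 <= C1 * E2) by (apply Rmult_le_pos; assumption).
  (* The first summand handles t >= d, where the crude bound pA is at most (pA/d) t. The others
     collect E3 t + C1 (L + E2 t) from the comparison with y. *)
  exists (INR p * A / d + (E3 + C1 * E2 + C1)). split; [lra|].
  intros x w Ox W. set (t := - D nil x). set (L := sumR p (fun k => Rabs (dot n (w k) (grad n D x)))).
  assert (Ht : 0 < t) by (unfold t; specialize (Neg x Ox); lra).
  assert (HL : 0 <= L) by (apply sumR_nonneg; intros; apply Rabs_pos).
  pose proof (Box x (Sub x Ox)) as Bx.
  assert (HT : 0 <= INR p * A / d * t) by (apply Rmult_le_pos; lra).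
  assert (HTL : 0 <= INR p * A / d * L) by (apply Rmult_le_pos; lra).
  assert (HK : forall a, 0 <= a -> 0 <= a * t /\ 0 <= a * L)
    by (intros; split; apply Rmult_le_pos; lra).
  pose proof (HK E3 HE3). pose proof (HK _ HCE). pose proof (HK C1 HC1).
  destruct (Rle_lt_dec d t) as [Hge|Hlt].
  - eapply Rle_trans; [|apply (trace_lower_bound n p (hess D x) B2 w); [|exact W]].
    + fold A. assert (INR p * A <= INR p * A / d * t); [|lra].
      apply Rle_trans with (INR p * A / d * d); [right; field; lra|].
      apply Rmult_le_compat_l; assumption.
    + intros i j Hi Hj. apply Q2; auto.
  - destruct (NB x Ox) as (y & By & Hy); [unfold t in Hlt; lra|]. fold t in Hy.
    pose proof (Box y (proj1 By)) as Boxy.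
    assert (Boxy' : in_box n (M + 1) y).
    { split; [apply Boxy|]. intros j Hj. pose proof (proj2 Boxy j Hj). lra. }
    assert (Dist : forall B, 0 <= B -> B * norm1 n (vsub y x) <= B * C0 * t).
    { intros B HB. rewrite Rmult_assoc. apply Rmult_le_compat_l; assumption. }
    assert (Hess : sumR p (fun k => bil n (hess D y) (w k) (w k)) - E3 * t
      <= sumR p (fun k => bil n (hess D x) (w k) (w k))).
    { rewrite <- (sumR_ext p (fun k => bil n (hess D x) (w k) (w k)
        + bil n (fun i j => hess D y i j - hess D x i j) (w k) (w k)) )
        by (intros; rewrite bil_minus_matrix; ring).
      rewrite sumR_plus.
      assert (Rabs (sumR p (fun k => bil n (fun i j => hess D y i j - hess D x i j) (w k) (w k)))
        <= E3 * t).
      { replace (E3 * t) with (INR p * (INR n * (1 * (INR n * (B3 * C0 * t * 1)))))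
          by (unfold E3; ring).
        apply sumR_abs_le. intros k Hk. apply bil_bound; try lra.
        - intros i j Hi Hj. unfold hess.
          eapply Rle_trans; [apply (lipschitz_on_box n D (j :: i :: nil) M B3); auto|].
          apply Dist, HB3.
        - intros. apply (orthonormal_coord n p); assumption.
        - intros. apply (orthonormal_coord n p); assumption. }
      pose proof (Rle_abs (sumR p (fun k =>
        bil n (fun i j => hess D y i j - hess D x i j) (w k) (w k)))). lra. }
    assert (Grad : sumR p (fun k => Rabs (dot n (w k) (grad n D y))) <= L + E2 * t).
    { unfold L. replace (E2 * t) with (INR p * (INR n * (1 * (B2 * C0 * t)))) by (unfold E2; ring).
      rewrite <- sumR_const, <- sumR_plus. apply sumR_le. intros k Hk.
      replace (dot n (w k) (grad n D y)) with (dot n (w k) (grad n D x)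
        + dot n (w k) (vsub (grad n D y) (grad n D x))) by (rewrite dot_vsub_r; ring).
      eapply Rle_trans; [apply Rabs_triang|]. apply Rplus_le_compat_l.
      apply dot_bound; [lra|intros; apply (orthonormal_coord n p); assumption|].
      intros i Hi. unfold vsub. rewrite !grad_coord by exact Hi.
      eapply Rle_trans; [apply (lipschitz_on_box n D (i :: nil) M B2); auto|].
      apply Dist, HB2. }
    assert (Gm : m <= dot n (grad n D y) (grad n D y)).
    { apply Nd; [apply By|]. rewrite (proj1 (proj2 Def y By)). lra. }
    assert (Ng : 0 < norm n (grad n D y)) by (apply sqrt_lt_R0; lra).
    pose proof (trace_near_tangent n p (hess D y) (grad n D y) B2 w HB2) as Key.
    fold A in Key.
    assert (Key' : - (C1 * (L + E2 * t)) <= sumR p (fun k => bil n (hess D y) (w k) (w k))).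
    { eapply Rle_trans; [apply Ropp_le_contravar|apply Key].
      - apply Rmult_le_compat; try assumption.
        + apply Rmult_le_pos; [apply Rmult_le_pos; lra|left; apply Rinv_0_lt_compat, Ng].
        + apply sumR_nonneg; intros; apply Rabs_pos.
        + apply Rmult_le_compat_l; [apply Rmult_le_pos; lra|].
          apply Rinv_le_contravar; [exact Hsm|]. apply sqrt_le_1_alt, Gm.
      - intros i j Hi Hj. apply Q2; auto.
      - apply inRn_grad.
      - lra.
      - exact W.
      (* The second fundamental form is the Hessian divided by |grad r|; multiplying back loses no
         sign. *)
      - intros w' W' Tan.
        pose proof (Conv y By (grad n D y) (hess D y) (tower_gradient n D y HD (proj1 Boxy))
          (tower_hessian n D y HD (proj1 Boxy)) w' W' Tan) as Cv.
        rewrite (sumR_ext p _ (fun k => norm n (grad n D y)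
          * (dot n (w' k) (matvec n (hess D y) (w' k)) / norm n (grad n D y)))).
        + rewrite sumR_scal. apply Rmult_le_pos; [lra|exact Cv].
        + intros k _. rewrite dot_matvec. field. lra. }
    lra.
Qed.

(** * Differentiation rules and derivatives of the weighted power *)

Lemma has_partial_mult f g i x a b : has_partial f i x a -> has_partial g i x b ->
  has_partial (fun y => f y * g y) i x (a * g x + f x * b).
Proof.
  intros Hf Hg. pose proof (derivable_pt_lim_mult _ _ _ _ _ Hf Hg) as H.
  cbv beta in H. rewrite vadd_zero in H. exact H.
Qed.

Lemma has_partial_plus f g i x a b : has_partial f i x a -> has_partial g i x b ->
  has_partial (fun y => f y + g y) i x (a + b).
Proof. apply derivable_pt_lim_plus. Qed.

Lemma has_partial_const c i x : has_partial (fun _ => c) i x 0.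
Proof. apply (derivable_pt_lim_const c). Qed.

Lemma has_partial_scal c f i x a : has_partial f i x a -> has_partial (fun y => c * f y) i x (c * a).
Proof.
  intros H. replace (c * a) with (0 * f x + c * a) by ring.
  apply (has_partial_mult (fun _ => c)); [apply has_partial_const|exact H].
Qed.

Lemma has_partial_comp F f i x l a : derivable_pt_lim F (f x) l -> has_partial f i x a ->
  has_partial (fun y => F (f y)) i x (l * a).
Proof.
  intros HF Hf. unfold has_partial.
  apply (derivable_pt_lim_comp (fun t => f (vadd x (vscale t (ei i)))) F); [exact Hf|].
  rewrite vadd_zero. exact HF.
Qed.

Lemma derivable_pt_lim_Rinv z : z <> 0 -> derivable_pt_lim Rinv z (- / (z * z)).
Proof.
  intros Hz. replace (- / (z * z)) with ((0 * id z - 1 * fct_cte 1 z) / Rsqr (id z))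
    by (unfold id, fct_cte, Rsqr; field; exact Hz).
  pose proof (derivable_pt_lim_div (fct_cte 1) id z 0 1 (derivable_pt_lim_const 1 z)
    (derivable_pt_lim_id z) Hz) as H.
  intros e He. destruct (H e He) as [d Hd]. exists d. intros h Hh Hhd.
  specialize (Hd h Hh Hhd). unfold div_fct, fct_cte, id, Rdiv in *. rewrite !Rmult_1_l in *. exact Hd.
Qed.

(** This is -rho; each differentiation reproduces it as a factor. *)
Definition power_weight (r phi : vec -> R) (K eta : R) (x : vec) : R := Rpower (- r x * exp (- K * phi x)) eta.

(** Logarithmic derivative: the logarithm of the weight is eta (log(-r) - K phi). *)
Lemma has_partial_power_weight r phi K eta i x a b : r x < 0 ->
  has_partial r i x a -> has_partial phi i x b ->
  has_partial (power_weight r phi K eta) i x (- (power_weight r phi K eta x * (eta * (a * / - r x + K * b)))).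
Proof.
  intros Hr Ha Hb. pose proof (exp_pos (- K * phi x)) as He.
  assert (Hz : 0 < - r x * exp (- K * phi x)) by (apply Rmult_lt_0_compat; lra).
  pose proof (has_partial_comp exp _ _ _ _ _ (derivable_pt_lim_exp (- K * phi x))
    (has_partial_scal (- K) phi i x b Hb)) as P1.
  pose proof (has_partial_mult _ _ _ _ _ _ (has_partial_scal (-1) r i x a Ha) P1) as P2.
  assert (E : (fun y => -1 * r y * exp (- K * phi y)) = (fun y => - r y * exp (- K * phi y))).
  { apply functional_extensionality. intros y. ring. }
  cbv beta in P2. rewrite E in P2.
  pose proof (has_partial_comp (fun z => Rpower z eta) _ _ _ _ _
    (derivable_pt_lim_power _ eta Hz) P2) as P3.
  unfold power_weight at 2. unfold Rminus in P3.
  rewrite Rpower_plus, Rpower_Ropp, Rpower_1 in P3 by exact Hz.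
  match type of P3 with has_partial _ _ _ ?l => match goal with |- has_partial _ _ _ ?l' =>
    replace l' with l; [exact P3|field; lra] end end.
Qed.

(** With W the weight, t = -r and g = dr/t + K dphi, the gradient of rho is W eta g. Differentiating
    again gives W eta (Dg - eta g g), and the factor t^2 clears the denominators. *)
Lemma hessian_neg_power_weight r phi K eta n Dr Dphi x : partial_tower n Dr -> partial_tower n Dphi ->
  Dr nil = r -> Dphi nil = phi -> inRn n x -> r x < 0 ->
  hessian_at n (fun y => - power_weight r phi K eta y) x
    (fun i j => power_weight r phi K eta x * eta * / (r x * r x) *
      (- r x * hess Dr x i j + grad n Dr x i * grad n Dr x j + K * (r x * r x) * hess Dphi x i j
       - eta * ((grad n Dr x i - K * r x * grad n Dphi x i)
                * (grad n Dr x j - K * r x * grad n Dphi x j)))).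
Proof.
  intros HDr HDphi Er Ephi Ix Hr.
  exists (fun i y => power_weight r phi K eta y * (eta * (Dr (i :: nil) y * / - r y + K * Dphi (i :: nil) y))).
  assert (Pr : forall i y, (i < n)%nat -> inRn n y -> has_partial r i y (Dr (i :: nil) y)).
  { intros. subst r. apply HDr; assumption. }
  assert (Pphi : forall i y, (i < n)%nat -> inRn n y -> has_partial phi i y (Dphi (i :: nil) y)).
  { intros. subst phi. apply HDphi; assumption. }
  split.
  (* The gradient formula must hold on a neighbourhood; the margin -r(x) in continuity keeps r
     negative there. *)
  - assert (Cr : cont_Rn n r) by (subst r; apply HDr).
    destruct (Cr x Ix (- r x)) as (d & Hd & Near); [lra|].
    exists d. split; [exact Hd|]. intros y Iy Hy i Hi.
    specialize (Near y Iy Hy). apply Rabs_def2 in Near.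
    pose proof (has_partial_scal (-1) _ _ _ _
      (has_partial_power_weight r phi K eta i y _ _ ltac:(lra) (Pr i y Hi Iy) (Pphi i y Hi Iy))) as P.
    replace (fun y => - power_weight r phi K eta y) with (fun y => -1 * power_weight r phi K eta y)
      by (apply functional_extensionality; intros; ring).
    match type of P with has_partial _ _ _ ?l => match goal with |- has_partial _ _ _ ?l' =>
      replace l' with l; [exact P|ring] end end.
  - intros i j Hi Hj.
    assert (Pinv : has_partial (fun y => / - r y) j x (- / (- r x * - r x) * (-1 * Dr (j :: nil) x))).
    { replace (fun y => / - r y) with (fun y => / (-1 * r y))
        by (apply functional_extensionality; intros; f_equal; ring).
      apply (has_partial_comp Rinv (fun y => -1 * r y)); [|apply has_partial_scal, Pr; assumption].
      replace (-1 * r x) with (- r x) by ring. apply derivable_pt_lim_Rinv. lra. }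
    pose proof (has_partial_mult _ _ _ _ _ _
      (has_partial_power_weight r phi K eta j x _ _ Hr (Pr j x Hj Ix) (Pphi j x Hj Ix))
      (has_partial_scal eta _ _ _ _ (has_partial_plus _ _ _ _ _ _
        (has_partial_mult _ _ _ _ _ _ (proj2 (HDr (i :: nil)) j Hj x Ix) Pinv)
        (has_partial_scal K _ _ _ _ (proj2 (HDphi (i :: nil)) j Hj x Ix))))) as P.
    match type of P with has_partial _ _ _ ?l => match goal with |- has_partial _ _ _ ?l' =>
      replace l' with l; [exact P|] end end.
    rewrite !grad_coord by assumption. unfold hess. field. lra.
Qed.

(** * From the Hessian to traces over frames, and the choice of constants *)

Lemma bil_combination n c1 c2 c3 c4 H G H' V w :
  bil n (fun i j => c1 * (c2 * H i j + G i * G j + c3 * H' i j - c4 * (V i * V j))) w w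
  = c1 * (c2 * bil n H w w + dot n w G * dot n w G + c3 * bil n H' w w
          - c4 * (dot n w V * dot n w V)).
Proof.
  unfold bil.
  rewrite (sumR_ext n _ (fun i => c1 * (c2 * (w i * sumR n (fun j => H i j * w j))
    + dot n w G * (w i * G i) + c3 * (w i * sumR n (fun j => H' i j * w j))
    - c4 * (dot n w V * (w i * V i))))).
  - rewrite sumR_scal, sumR_minus, !sumR_plus, !sumR_scal. unfold dot. ring.
  - intros i _.
    rewrite (sumR_ext n _ (fun j => c1 * (c2 * (H i j * w j) + G i * (w j * G j)
      + c3 * (H' i j * w j) - c4 * (V i * (w j * V j))))) by (intros; ring).
    rewrite sumR_scal, sumR_minus, !sumR_plus, !sumR_scal. unfold dot. ring.
Qed.

(* T and F are the traces of Hess r and Hess phi; a and b are the values of dr and dphi on the frame. *)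
Lemma trace_form_positive p C c B K eta t T F (a b : nat -> R) :
  0 <= C -> 0 < c -> 0 < t -> 0 < eta -> 0 <= B ->
  K * c = C + INR p * C ^ 2 + 1 -> eta * (4 + 2 * K ^ 2 * B) < 1 ->
  - (C * (t + sumR p (fun k => Rabs (a k)))) <= T -> c <= F ->
  sumR p (fun k => b k * b k) <= B ->
  0 < t * T + sumR p (fun k => a k * a k) + K * (t * t) * F
      - eta * sumR p (fun k => (a k + K * t * b k) * (a k + K * t * b k)).
Proof.
  intros HC Hc Ht Heta HB HK Hsmall HT HF Hb.
  assert (HK0 : 0 < K).
  { apply Rmult_lt_reg_r with c; [exact Hc|]. rewrite HK, Rmult_0_l.
    pose proof (Rmult_le_pos _ _ (pos_INR p) (pow2_ge_0 C)). lra. }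
  set (L := sumR p (fun k => Rabs (a k))) in *.
  set (A := sumR p (fun k => a k * a k)).
  set (X := sumR p (fun k => (a k + K * t * b k) * (a k + K * t * b k))).
  assert (HA : 0 <= A) by (apply sumR_nonneg; intros; apply Rle_0_sqr).
  assert (S1 : C * t * L <= A / 4 + INR p * (C ^ 2 * t ^ 2)).
  { unfold L, A, Rdiv. rewrite (Rmult_comm _ (/ 4)), <- !sumR_scal, <- sumR_const, <- sumR_plus.
    apply sumR_le. intros k _.
    assert (a k * a k = Rabs (a k) * Rabs (a k)) as -> by exact (Rsqr_abs (a k)).
    pose proof (Rle_0_sqr (Rabs (a k) / 2 - C * t)) as Sq. unfold Rsqr in Sq. lra. }
  assert (S2 : X <= 2 * A + 2 * (K ^ 2 * t ^ 2) * B).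
  { apply Rle_trans with (2 * A + 2 * (K ^ 2 * t ^ 2) * sumR p (fun k => b k * b k)).
    - unfold X, A. rewrite <- !sumR_scal, <- sumR_plus. apply sumR_le. intros k _.
      pose proof (Rle_0_sqr (a k - K * t * b k)) as Sq. unfold Rsqr in Sq. lra.
    - apply Rplus_le_compat_l, Rmult_le_compat_l; [|exact Hb]. nra. }
  assert (S3 : - (C * t * t) - C * t * L <= t * T) by nra.
  assert (S4 : t * t * (C + INR p * C ^ 2 + 1) <= K * (t * t) * F).
  { rewrite <- HK. replace (t * t * (K * c)) with (K * (t * t) * c) by ring.
    apply Rmult_le_compat_l; [|exact HF]. apply Rmult_le_pos; [lra|nra]. }
  assert (S5 : eta * X <= eta * (2 * A) + eta * (2 * K ^ 2 * B) * (t * t)).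
  { apply (Rmult_le_compat_l eta) in S2; lra. }
  assert (HKB : 0 <= 2 * K ^ 2 * B) by (pose proof (pow2_ge_0 K); nra).
  assert (0 <= eta * (2 * K ^ 2 * B)) by nra.
  (* Here eta < 1/4, so at most A/2 is used, after A/4 for the linear term; the total stays below A.
     In the t^2 terms the surplus 1 in K c outweighs eta times 2 K^2 B. *)
  assert (eta * (2 * A) <= / 4 * (2 * A)) by (apply Rmult_le_compat_r; lra).
  assert (0 < t * t) by nra.
  assert (eta * (2 * K ^ 2 * B) * (t * t) < 1 * (t * t)) by (apply Rmult_lt_compat_r; lra).
  lra.
Qed.

Lemma grad_trace_bounded n p D M : partial_tower n D ->
  exists B, 0 <= B /\ forall x w, in_box n M x -> orthonormal n p w ->
    sumR p (fun k => dot n (w k) (grad n D x) * dot n (w k) (grad n D x)) <= B.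
Proof.
  intros HD. destruct (partials_bounded n D M 1 nil HD) as (B & HB & P).
  pose proof (pos_INR n). set (c := INR n * (1 * B)).
  assert (Hc : 0 <= c) by (unfold c; nra).
  exists (INR p * (c * c)). split; [apply Rmult_le_pos; [apply pos_INR|nra]|].
  intros x w Bx W. rewrite <- sumR_const. apply sumR_le. intros k Hk.
  assert (Rabs (dot n (w k) (grad n D x)) <= c).
  { apply dot_bound; [lra|intros; apply (orthonormal_coord n p); assumption|].
    intros i Hi. rewrite grad_coord by exact Hi.
    apply (P (i :: nil)); [reflexivity|intros a [<-|[]]; exact Hi|exact Bx]. }
  apply (Rsqr_le_abs_1 _ c). rewrite (Rabs_right c) by lra. assumption.
Qed.

Theorem theorem2p1 :
  forall (n p : nat) (Omega : vec -> Prop) (r phi : vec -> R),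
    (1 <= p)%nat -> (p <= n)%nat ->
    (forall x, Omega x -> inRn n x) ->
    open_Rn n Omega -> bounded_Rn n Omega ->
    smooth n r -> defining_function n Omega r ->
    p_convex_boundary n p Omega r ->
    smooth n phi -> strictly_p_psh n p phi (closure n Omega) ->
    exists K eta0, 0 < K /\ 0 < eta0 < 1 /\
      forall eta, 0 < eta < eta0 ->
        strictly_p_psh n p
          (fun x => - Rpower (- r x * exp (- K * phi x)) eta) Omega.
Proof.
  intros n p Omega r phi Hp Hpn HI HO Hbd (Dr & Er & HDr) Def Conv (Dphi & Ephi & HDphi) Psh.
  change (partial_tower n Dr) in HDr. change (partial_tower n Dphi) in HDphi.
  destruct (closure_in_box n Omega Hbd) as [M Box].
  destruct (uniform_trace_positive n p Omega Dphi M HDphi Hp Hpn Box) as (c & Hc & Tphi).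
  { rewrite Ephi. exact Psh. }
  destruct (trace_defining_function n p Omega Dr M HDr HI HO) as (C & HC & Tr);
    [rewrite Er; exact Def|rewrite Er; exact Conv|exact Box|].
  destruct (grad_trace_bounded n p Dphi M HDphi) as (B & HB & Gphi).
  (* K c must cover C from the t^2 part of t tr Hess r, p C^2 from completing p squares, and a
     surplus 1 left for the eta term. *)
  set (K := (C + INR p * C ^ 2 + 1) / c).
  assert (HK : 0 < K).
  { apply Rdiv_lt_0_compat; [|exact Hc].
    pose proof (Rmult_le_pos _ _ (pos_INR p) (pow2_ge_0 C)). lra. }
  assert (HKB : 0 <= 2 * K ^ 2 * B) by (pose proof (pow2_ge_0 K); nra).
  (* The 4 keeps the eta term below a fraction of dr^2 and puts [eta0] below 1; 2 K^2 B balances the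
     dphi part against the surplus. *)
  exists K, (/ (4 + 2 * K ^ 2 * B)). split; [exact HK|]. split.
  { split; [apply Rinv_0_lt_compat; lra|]. rewrite <- Rinv_1. apply Rinv_lt_contravar; lra. }
  intros eta [Heta Hsmall] x Ox.
  assert (Hsmall' : eta * (4 + 2 * K ^ 2 * B) < 1).
  { rewrite <- (Rinv_l (4 + 2 * K ^ 2 * B)) by lra. apply Rmult_lt_compat_r; lra. }
  pose proof (HI x Ox) as Ix. pose proof (subset_closure n Omega x HI Ox) as Cx.
  pose proof (proj1 Def x Ox) as Hr.
  eexists. split.
  { exact (hessian_neg_power_weight r phi K eta n Dr Dphi x HDr HDphi Er Ephi Ix Hr). }
  apply p_pos_def_of_trace.
  - intros i j Hi Hj. unfold hess.
    rewrite (second_partials_commute n Dr i j x), (second_partials_commute n Dphi i j x)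
      by assumption.
    ring.
  - intros w W.
    set (V := fun i => grad n Dr x i - K * r x * grad n Dphi x i).
    assert (HV : forall k, dot n (w k) V = dot n (w k) (grad n Dr x)
      + K * - r x * dot n (w k) (grad n Dphi x)).
    { intros k. change V with (vsub (grad n Dr x) (vscale (K * r x) (grad n Dphi x))).
      rewrite dot_vsub_r, dot_vscale_r. ring. }
    rewrite (sumR_ext p _ (fun k => power_weight r phi K eta x * eta * / (r x * r x) *
      (- r x * bil n (hess Dr x) (w k) (w k)
       + dot n (w k) (grad n Dr x) * dot n (w k) (grad n Dr x)
       + K * (r x * r x) * bil n (hess Dphi x) (w k) (w k)
       - eta * (dot n (w k) V * dot n (w k) V)))).
    2:{ intros k _. apply (bil_combination n _ _ _ _ (hess Dr x) (grad n Dr x) (hess Dphi x) V). }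
    rewrite sumR_scal, sumR_minus, !sumR_plus, !sumR_scal.
    apply Rmult_lt_0_compat.
    (* [Rpower] is by definition an exponential, hence [exp_pos]. *)
    + apply Rmult_lt_0_compat; [apply Rmult_lt_0_compat; [apply exp_pos|exact Heta]|].
      apply Rinv_0_lt_compat. nra.
    + rewrite (sumR_ext p (fun k => dot n (w k) V * dot n (w k) V) (fun k =>
        (dot n (w k) (grad n Dr x) + K * - r x * dot n (w k) (grad n Dphi x))
        * (dot n (w k) (grad n Dr x) + K * - r x * dot n (w k) (grad n Dphi x))))
        by (intros; rewrite HV; reflexivity).
      replace (r x * r x) with (- r x * - r x) by ring.
      apply (trace_form_positive p C c B); auto; try lra.
      * unfold K. field. lra.
      * rewrite <- Er. apply Tr; assumption.
Qed.
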